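(* Let $\mathcal{G}$ be an infinite connected undirected graph all of whose vertices have finite degree, and let $p$ be such that $p_c(\mathcal{G},1)<p<1$. For $q\in(0,1]$ let $\eta_q$ be a $0$-$1$ random variable with $\mathbf{P}[\eta_q=1]=1-\mathbf{P}[\eta_q=0]=q$. Then there is a phase transition in $q$, i.e., $\mathrm{FM}(\mathcal{G},p,\eta_q)$ dies out when $q$ is small and survives when $q$ is large: there exist $0<q_0\le q_1<1$ such that $\mathrm{FM}(\mathcal{G},p,\eta_q)$ dies out almost surely for all $q<q_0$ and survives with positive probability for all $q>q_1$.
   Context: Frog model $\mathrm{FM}(\mathcal{G},p,\eta)$. Let $\mathcal{G}$ be an infinite connected undirected graph all of whose sites (vertices) have finite degree, with a fixed site $\mathbf{0}$ called the root; let $p\in[0,1]$ and let $\eta$ be a random variable with values in $\mathbb{N}=\{0,1,2,\dots\}$. Let $\{\eta(x)\}_{x}$, $\{(S^x_n(i))_{n\in\mathbb{N}}\}_{x,\,i\ge1}$, $\{\Xi^x_p(i)\}_{x,\,i\ge 1}$ be independent families of independent random variables, where $\eta(x)$ has the law of $\eta$, $(S^x_n(i))_n$ is a discrete-time simple random walk on $\mathcal{G}$ started from $x$, and $\mathbf{P}[\Xi^x_p(i)=k]=(1-p)p^{k-1}$, $k=1,2,\dots$ (for $p=1$, $\Xi^x_p(i)=\infty$, no death). Site $x$ initially contains $\eta(x)$ particles; at time $0$ all particles are sleeping except those at the root, which are active. If the particles of site $x$ are activated at time $T(x)$, the $i$-th of them ($1\le i\le\eta(x)$) is active and located at $S^x_n(i)$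 at time $T(x)+n$ for $0\le n<\Xi^x_p(i)$, and then disappears. When an active particle visits a site, all sleeping particles there become active. Formally, $t(x,y)=\min_{1\le i\le\eta(x)}\min\{n<\Xi^x_p(i):S^x_n(i)=y\}$ for $x\ne y$ ($\infty$ if there is no such $n$), and $T(x)=\inf\{t(x_0,x_1)+\dots+t(x_{m-1},x_m)\}$ over all finite sequences $\mathbf{0}=x_0,x_1,\dots,x_m=x$, with $T(\mathbf{0})=0$; $T(x)=\infty$ means that $x$ is never visited by active particles. The model survives if at every time there is at least one active particle; otherwise it dies out. The critical parameter is $p_c(\mathcal{G},\eta)=\inf\{p\in[0,1]:\mathbf{P}[\mathrm{FM}(\mathcal{G},p,\eta)\text{ survives}]>0\}$, and $p_c(\mathcal{G},1)$ is the critical parameter for $\eta\equiv1$ (one particle per site). *)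

(* Defs.v *)
From HB Require Import structures.
From mathcomp Require Import all_boot all_order all_algebra finmap.
From mathcomp Require Import all_classical all_reals all_analysis measurable_realfun.
Set Implicit Arguments.
Unset Strict Implicit.
Unset Printing Implicit Defensive.
Import Order.TTheory GRing.Theory Num.Theory.
Local Open Scope classical_set_scope.
Local Open Scope ring_scope.
Local Open Scope ereal_scope.

Record infinite_connected_graph (V : choiceType) (e : rel V) : Prop := {
  graph_sym : symmetric e;
  graph_irr : irreflexive e;
  graph_locally_finite : forall x, finite_set [set y | e x y];
  graph_connected : forall x y, exists s, path e x s /\ last x s = y;
  graph_infinite : infinite_set [set: V] }.

Definition degree (V : choiceType) (e : rel V) (x : V) : nat :=
  #|` fset_set [set y | e x y]|%fset.

(* Probability that a simple random walk started from [x] follows [x :: s]. *)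
Fixpoint srw_path_prob (R : realType) (V : choiceType) (e : rel V)
    (x : V) (s : seq V) : R :=
  if s is y :: s' then
    ((if e x y then (degree e x)%:R^-1 else 0) * srw_path_prob R e y s')%R
  else 1%R.

(* Mutual independence of a family of classes of events. *)
Definition mutually_independent (R : realType) (d : measure_display)
    (T : measurableType d) (P : probability T R) (I : choiceType)
    (F : I -> set (set T)) : Prop :=
  forall (J : {fset I}) (A : I -> set T),
    (forall i, i \in J -> F i (A i)) ->
    P (\bigcap_(i in [set` J]) A i) = \prod_(i <- J) P (A i).

(* Index set of the families eta(x), S^x(i), Xi^x(i). *)
Definition frog_index (V : choiceType) : choiceType :=
  (V + (V * nat) + (V * nat))%type.

Definition frog_events (R : realType) (V : choiceType) (T : Type)
    (eta : V -> T -> nat) (walk : V -> nat -> nat -> T -> V)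
    (life : V -> nat -> T -> \bar R) (k : frog_index V) : set (set T) :=
  match k with
  | inl (inl x) => preimage_set_system setT (eta x) measurable
  | inl (inr (x, i)) =>
      <<s [set A | exists n (B : set V), A = walk x i n @^-1` B] >>
  | inr (x, i) => preimage_set_system setT (life x i) measurable
  end.

(* A realisation of FM(G, p, eta) on (T, P), with [law] the law of eta. The
   particles of [x] are numbered from 0: those present are [i < eta x]. The
   countable set [V] carries the discrete sigma-algebra. [life x i] takes
   almost surely its values in {1, 2, ...} together with [+oo]. *)
Record frog_model (R : realType) (V : choiceType) (e : rel V) (p : R)
    (law : probability nat R) (d : measure_display) (T : measurableType d)
    (P : probability T R) := FrogModel {
  eta : V -> {RV P >-> nat};
  walk : V -> nat -> nat -> T -> V;
  life : V -> nat -> {RV P >-> \bar R};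
  eta_law : forall x B, distribution P (eta x) B = law B;
  walk_measurable : forall x i n (B : set V), measurable (walk x i n @^-1` B);
  walk_law : forall x i (s : seq V),
    P [set w | forall k, (k <= size s)%N -> walk x i k w = nth x (x :: s) k] =
    (srw_path_prob R e x s)%:E;
  life_law : forall x i k,
    distribution P (life x i) [set k.+1%:R%:E] = ((1 - p) * p ^+ k)%:E;
  life_infinite : forall x i, p = 1%R ->
    distribution P (life x i) [set +oo] = 1;
  frog_independent : mutually_independent P
    (frog_events (fun x => eta x : T -> nat) walk
                 (fun x i => life x i : T -> \bar R)) }.

Section dynamics.
Variables (R : realType) (V : choiceType) (e : rel V) (p : R).
Variables (law : probability nat R) (d : measure_display).
Variables (T : measurableType d) (P : probability T R).
Variables (M : frog_model e p law P) (root : V).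

(* t(x, y) *)
Definition hitting_time (w : T) (x y : V) : \bar R :=
  ereal_inf [set z | exists i n : nat,
    [/\ (i < eta M x w)%N, n%:R%:E < life M x i w,
        walk M x i n w = y & z = n%:R%:E]].

Fixpoint path_time (w : T) (x : V) (s : seq V) : \bar R :=
  if s is y :: s' then hitting_time w x y + path_time w y s' else 0.

(* T(x). The sequences are not required to have distinct consecutive terms:
   this does not change the infimum, since hitting times are nonnegative. *)
Definition activation_time (w : T) (x : V) : \bar R :=
  ereal_inf [set path_time w root s | s in [set s | last root s = x]].

(* At time [m] the [i]-th particle of some site [x] has age [n] and is alive. *)
Definition active_particle_at (w : T) (m : nat) : Prop :=
  exists (x : V) (i n : nat),
    [/\ (i < eta M x w)%N, n%:R%:E < life M x i w
      & activation_time w x + n%:R%:E = m%:R%:E].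

Definition survives : set T := [set w | forall m, active_particle_at w m].

End dynamics.

(* Any realisation may be used: the probability of survival depends only on
   the joint law of the families, which [frog_model] determines. *)
Definition survives_with_positive_probability (R : realType) (V : choiceType)
    (e : rel V) (root : V) (p : R) (law : probability nat R) : Prop :=
  exists (d : measure_display) (T : measurableType d) (P : probability T R)
    (M : frog_model e p law P), 0 < P (survives M root).

Definition critical_parameter (R : realType) (V : choiceType) (e : rel V)
    (root : V) (law : probability nat R) : \bar R :=
  ereal_inf [set p%:E | p in [set p : R | (0 <= p <= 1)%R /\
    survives_with_positive_probability e root p law]].

(* Main.v *)
(* Survival is almost surely the existence, for every k, of a chain of k + 1
   distinct sites issued from the root, each visited by the particle of the
   preceding one. Since distinct sites are independent, the expected number of
   chains is at most (q p / (1 - p))^k, which gives extinction for small q.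
   For large q, let FM(G, p', 1) survive with p' < p. The particle of a site makes
   at least l >= 1 steps with probability q p^l, respectively p'^l, so the steps
   of FM(G, p, eta_q) dominate those of FM(G, p', 1) as soon as q p >= p'. *)
Require Import Defs.
From HB Require Import structures.
From mathcomp Require Import all_boot all_order all_algebra finmap.
From mathcomp Require Import all_classical all_reals all_analysis measurable_realfun.
From mathcomp Require Import ring zify.
Set Implicit Arguments.
Unset Strict Implicit.
Unset Printing Implicit Defensive.
Import Order.TTheory GRing.Theory Num.Theory.
Import numFieldNormedType.Exports.
Local Open Scope classical_set_scope.
Local Open Scope ring_scope.
Local Open Scope ereal_scope.

(** * Balls and nearest-neighbour paths *)

(** The two models to be compared live on unrelated probability spaces, and no coupling between them
    is built. Truncation replaces it: with the sites confined to a ball of radius [N] and the ages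
    to at most [N], the existence of a chain involves finitely many variables with finitely many
    relevant values, so that its probability is a finite sum determined by the law of the model. A
    chain forgets the times of its visits, hence its existence is monotone in the set of sites that
    each particle visits, and the two laws can be exchanged one site at a time. The comparison
    passes to the limit because the truncated events increase with [N], while the existence of a
    chain of length [k] decreases with [k]. The inequality between the tails uses [l >= 1] in p'^l
    <= (q p)^l <= q p^l. The case [l = 0] is harmless: an absent particle visits exactly what a
    particle making no step visits, namely nothing. *)

Section graph.
Variables (V : choiceType) (e : rel V) (root : V).
Hypothesis G : infinite_connected_graph e.

Definition neighbours (x : V) : seq V := fset_set [set y | e x y].

Lemma mem_neighbours x y : (y \in neighbours x) = e x y.
Proof.
rewrite /neighbours in_fset_set; last exact: graph_locally_finite.
by apply/idP/idP; rewrite inE.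
Qed.

(** Some other vertex exists because the graph is infinite, and a path leading to it starts with an
    edge at [x]. Division by the degree in [srw_path_prob] is thus a true division. *)
Lemma degree_gt0 x : (0 < degree e x)%N.
Proof.
rewrite /degree -[fset_set _]/(fset_set _ : {fset V}).
have [y yx] : exists y, y <> x.
  apply: contrapT => /forallNP h; apply: (graph_infinite G).
  apply: (@sub_finite_set _ _ [set x]); last exact: finite_set1.
  by move=> y _; have /contrapT := h y.
have [[|z s] [/= es ls]] := graph_connected G x y; first by case: yx.
have exz : e x z by case/andP: es.
rewrite cardfs_gt0; apply/fset0Pn; exists z.
by rewrite -[_ \in _]/(z \in neighbours x) mem_neighbours.
Qed.

Fixpoint ball (n : nat) : seq V :=
  if n is n'.+1
  then undup (ball n' ++ flatten [seq neighbours x | x <- ball n'])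
  else [:: root].

Lemma ball_uniq n : uniq (ball n).
Proof. by case: n => //= n; rewrite undup_uniq. Qed.

Lemma ball_subS n : {subset ball n <= ball n.+1}.
Proof. by move=> x xn; rewrite /= mem_undup mem_cat xn. Qed.

Lemma ball_sub m n : (m <= n)%N -> {subset ball m <= ball n}.
Proof.
elim: n => [|n IH]; first by rewrite leqn0 => /eqP ->.
rewrite leq_eqVlt => /orP[/eqP -> //|mn] x xm.
by apply: ball_subS; exact: IH.
Qed.

Lemma root_ball n : root \in ball n.
Proof. by apply: (@ball_sub 0) => //=; rewrite inE. Qed.

Lemma ball_step n x y : x \in ball n -> e x y -> y \in ball n.+1.
Proof.
move=> xn exy; rewrite /= mem_undup mem_cat; apply/orP; right.
by apply/flattenP; exists (neighbours x); [exact: map_f|rewrite mem_neighbours].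
Qed.

Lemma ball_path n x s : x \in ball n -> path e x s ->
  last x s \in ball (n + size s).
Proof.
elim: s x n => [|y s IH] x n xn /=; first by rewrite addn0.
by case/andP=> exy es; rewrite addnS -addSn; apply: IH => //; exact: ball_step exy.
Qed.

Lemma ball_cover x : exists n, x \in ball n.
Proof.
have [s [es <-]] := graph_connected G root x.
by exists (0 + size s)%N; apply: ball_path => //; exact: root_ball.
Qed.

Lemma ball_all (s : seq V) : exists n, {subset s <= ball n}.
Proof.
elim: s => [|x s [n sn]]; first by exists 0%N.
have [m xm] := ball_cover x; exists (maxn n m) => y; rewrite inE.
case/predU1P => [->|/sn].
- exact: ball_sub (leq_maxr _ _) _ xm.
- exact: ball_sub (leq_maxl _ _) _.
Qed.

Lemma countable_vertices : countable [set: V].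
Proof.
have -> : [set: V] = \bigcup_n [set` ball n].
  apply/seteqP; split => // x _; have [n xn] := ball_cover x.
  by exists n.
apply: bigcup_countable => // n _.
by apply: finite_set_countable; exact: finite_seq.
Qed.

Lemma countable_vertex_seqs : countable [set: seq V].
Proof.
have /countable_injP[f fi] := countable_vertices.
apply/countable_injP; exists (fun s => choice.pickle (map f s)) => s t _ _.
move=> /(pcan_inj choice.pickleK) /inj_map -> // x y.
by apply: fi; rewrite inE.
Qed.

Fixpoint walks (n : nat) (x : V) : seq (seq V) :=
  if n is n'.+1
  then [seq y :: s | y <- neighbours x, s <- walks n' y] else [:: [::]].

Lemma walks_uniq n x : uniq (walks n x).
Proof.
elim: n x => //= n IH x; apply: allpairs_uniq_dep => //.
- exact: fset_uniq.
- by move=> [y s] [z t] _ _ /= [-> ->].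
Qed.

Lemma mem_walks n x s : s \in walks n x -> size s = n /\ path e x s.
Proof.
elim: n x s => /= [|n IH] x s; first by rewrite inE => /eqP ->.
move=> /allpairsPdep[y [t [yx tn ->]]] /=.
have [-> ->] := IH _ _ tn.
by rewrite mem_neighbours in yx; rewrite yx.
Qed.

(** [walk_law] prescribes only the probabilities of given trajectories; since those of the
    nearest-neighbour ones already add up to 1, all others are negligible. *)
Lemma sum_srw_path_prob (R : realType) n x :
  (\sum_(s <- walks n x) srw_path_prob R e x s = 1)%R.
Proof.
elim: n x => [|n IH] x; first by rewrite big_seq1.
rewrite [walks _ _]/= big_allpairs_dep /=.
transitivity (\sum_(y <- neighbours x) ((degree e x)%:R^-1 : R))%R.
  apply: eq_big_seq => y; rewrite mem_neighbours => exy.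
  by rewrite -big_distrr /= IH exy mulr1.
rewrite big_const_seq count_predT iter_addr_0 -[size _]/(degree e x).
rewrite -[LHS]mulr_natl divff //.
by rewrite pnatr_eq0 -lt0n degree_gt0.
Qed.

End graph.

(** * Lifetimes and trajectories *)

Lemma expr_lt_eps (R : realType) (r eps : R) : (0 <= r < 1)%R -> (0 < eps)%R ->
  exists m, forall n, (m <= n)%N -> (r ^+ n < eps)%R.
Proof.
move=> /andP[r0 r1] e0.
have /cvgrPdist_lt/(_ _ e0)[m _ hm] : (fun n => r ^+ n)%R @ \oo --> (0 : R)%R.
  by apply: cvg_expr; rewrite ger0_norm.
exists m => n mn; have := hm n mn.
by rewrite /= sub0r normrN ger0_norm // exprn_ge0.
Qed.

Lemma negligible_countable_bigcup (R : realType) d (T : measurableType d)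
    (mu : {measure set T -> \bar R}) (U : Type) (F : U -> set T) :
  countable [set: U] -> (forall u, mu.-negligible (F u)) ->
  mu.-negligible (\bigcup_u F u).
Proof.
elim/Ppointed: U => U in F *.
  by move=> *; rewrite empty_eq0 bigcup0 //; exact: negligible_set0.
move=> /countable_bijP[B] /ppcard_eqP[f] Fm.
rewrite (reindex_bigcup f^-1%FUN setT)//=; first exact: negligible_bigcup.
exact: (@subl_surj _ _ B).
Qed.

(** Additivity over the values of [X], with measurability required of the fibres only, since [C]
    carries no sigma-algebra. *)
Lemma measure_seq_partition (R : realType) d (T : measurableType d)
    (mu : {measure set T -> \bar R}) (C : choiceType) (X : T -> C) (B : set T)
    (A : seq C) : uniq A ->
  (forall a, a \in A -> measurable (B `&` [set w | X w = a])) ->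
  mu (B `&` [set w | X w \in A]) = \sum_(a <- A) mu (B `&` [set w | X w = a]).
Proof.
elim: A => [|a A IH] /=.
  move=> _ _; rewrite big_nil (_ : _ `&` _ = set0) ?measure0 //.
  by apply/seteqP; split => // w [].
move=> /andP[aA uA] mA.
have mA' b : b \in A -> measurable (B `&` [set w | X w = b]).
  by move=> bA; apply: mA; rewrite inE bA orbT.
rewrite big_cons -IH // -measureU.
- congr (mu _); apply/seteqP; split => w /=.
    by rewrite inE => -[Bw /predU1P[]]; [left|right].
  by rewrite inE => -[[Bw ->]|[Bw ->]]; rewrite ?eqxx ?orbT.
- by apply: mA; rewrite inE eqxx.
- rewrite (_ : _ `&` _ = \big[setU/set0]_(b <- A) (B `&` [set w | X w = b])).
    by rewrite big_seq; apply: bigsetU_measurable => b; exact: mA'.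
  rewrite -bigcup_seq; apply/seteqP; split => w /=.
    by move=> [Bw Xw]; exists (X w).
  by move=> [b bA [Bw Xb]]; split => //; rewrite Xb.
- apply/seteqP; split => // w [[_ Xw] [_]] /=.
  by rewrite Xw (negbTE aA).
Qed.

Lemma measurable_ereal_gt (R : realType) (r : \bar R) :
  measurable [set z | r < z].
Proof.
rewrite (_ : [set z | _] = [set` `]r, +oo[]); first exact: emeasurable_itv.
by apply/seteqP; split => z /=; rewrite in_itv /= andbT.
Qed.

Section laws.
Variables (R : realType) (V : choiceType) (e : rel V) (p : R).
Variables (law : probability nat R) (d : measure_display).
Variables (T : measurableType d) (P : probability T R).
Variable M : frog_model e p law P.

Let events : frog_index V -> set (set T) :=
  frog_events (fun x => Defs.eta M x : T -> nat) (walk M)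
    (fun x i => life M x i : T -> \bar R).

Lemma frog_events_measurable k A : events k A -> measurable A.
Proof.
case: k => [[x|[x i]]|[x i]] /=.
- by move=> [B mB <-]; apply: measurable_funP.
- apply: smallest_sub; first exact: sigma_algebra_measurable.
  by move=> _ [n [B ->]]; exact: walk_measurable.
- by move=> [B mB <-]; apply: measurable_funP.
Qed.

Lemma frog_events_eta x (B : set nat) :
  events (inl (inl x)) [set w | B (Defs.eta M x w)].
Proof. by exists B => //; rewrite setTI. Qed.

Lemma frog_events_life x i (B : set (\bar R)) : measurable B ->
  events (inr (x, i)) [set w | B (life M x i w)].
Proof. by move=> mB; exists B => //; rewrite setTI. Qed.

Lemma frog_events_walk x i n (B : set V) :
  events (inl (inr (x, i))) [set w | B (walk M x i n w)].
Proof. by apply: sub_sigma_algebra; exists n, B. Qed.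

Definition walk_prefix (N : nat) (x : V) (i : nat) (w : T) : seq V :=
  mkseq (fun n => walk M x i n w) N.+1.

Lemma frog_events_walk_prefix N x i s :
  events (inl (inr (x, i))) [set w | walk_prefix N x i w = s].
Proof.
set GG := [set A | exists n (B : set V), A = walk M x i n @^-1` B].
(* Membership in the generated sigma-algebra is read as measurability, so that closure under finite
   intersections applies. *)
suff : @measurable _ (g_sigma_algebraType GG) [set w | walk_prefix N x i w = s].
  by [].
have [sN|sN] := eqVneq (size s) N.+1; last first.
  rewrite (_ : [set w | _] = set0); first exact: measurable0.
  apply/seteqP; split => // w /= ws; case/negP: sN.
  by rewrite -ws size_mkseq.
rewrite (_ : [set w | _] =
    \big[setI/setT]_(n < N.+1) [set w | walk M x i n w = nth x s n]).
  apply: bigsetI_measurable => n _.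
  by apply: sub_sigma_algebra; exists n, [set nth x s n].
rewrite -bigcap_seq; apply/seteqP; split => w /=.
  by move=> ws n _; rewrite -ws nth_mkseq.
move=> ws; apply: (@eq_from_nth _ x); first by rewrite size_mkseq.
move=> n; rewrite size_mkseq => nN; rewrite nth_mkseq //.
by apply: (ws (Ordinal nN)); rewrite /= mem_index_enum.
Qed.

Lemma walk_prefix_law x i s :
  P [set w | walk_prefix (size s) x i w = x :: s] = (srw_path_prob R e x s)%:E.
Proof.
rewrite -(walk_law M x i s); congr (P _); apply/seteqP; split => w /=.
  by move=> ws k ks; rewrite -ws nth_mkseq.
move=> ws; apply: (@eq_from_nth _ x); first by rewrite size_mkseq.
move=> n; rewrite size_mkseq => nN; rewrite nth_mkseq //.
exact: ws.
Qed.

Hypothesis p01 : (0 <= p < 1)%R.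

(** [life_law] gives the mass of each positive integer only; tails have to be recovered from finite
    unions of such atoms. *)
Let life_le x i n w := exists2 k, (k < n)%N & life M x i w = k.+1%:R%:E.

Let life_le_prob x i n :
  measurable [set w | life_le x i n w] /\
  P [set w | life_le x i n w] = (1 - p ^+ n)%:E.
Proof.
have mk k : measurable [set w | life M x i w = k.+1%:R%:E].
  by apply/frog_events_measurable/(frog_events_life x i (emeasurable_set1 _)).
elim: n => [|n [mA IH]].
  rewrite (_ : [set w | _] = set0) ?measure0 ?expr0 ?subrr //.
  by apply/seteqP; split => // w [].
have -> : [set w | life_le x i n.+1 w] =
    [set w | life_le x i n w] `|` [set w | life M x i w = n.+1%:R%:E].
  apply/seteqP; split => w /=.
    move=> [k]; rewrite ltnS leq_eqVlt => /predU1P[->|kn] lk; first by right.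
    by left; exists k.
  by move=> [[k kn lk]|lk]; [exists k => //; exact: ltnW|exists n].
split; first exact: measurableU.
rewrite measureU //; last first.
  apply/seteqP; split => // w [[k kn /= ->]] [/eqP].
  by rewrite eqr_nat eqSS => /eqP kn'; move: kn; rewrite kn' ltnn.
have /= := life_law M x i n; rewrite /pushforward /= => h.
rewrite IH (_ : P _ = ((1 - p) * p ^+ n)%:E) // -EFinD.
by congr (_%:E); rewrite mulrBl mul1r -exprS addrA subrK.
Qed.

(** The event avoids the integer lifetimes up to [n], which bounds it above. It contains the integer
    lifetimes between [n] and any larger bound, which bounds it below, because the atoms exhaust the
    mass when p < 1. *)
Lemma life_gt_prob x i n : P [set w | n%:R%:E < life M x i w] = (p ^+ n)%:E.
Proof.
have ml : measurable [set w | n%:R%:E < life M x i w].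
  exact/frog_events_measurable/(frog_events_life x i (measurable_ereal_gt _)).
apply/eqP; rewrite eq_le; apply/andP; split.
  have [mA PA] := life_le_prob x i n.
  rewrite (_ : (p ^+ n)%:E = P (~` [set w | life_le x i n w])); last first.
    by rewrite probability_setC // PA -EFinB subKr.
  apply: le_measure; rewrite ?inE //; first exact: measurableC.
  move=> w /= nl [k kn lk]; move: nl; rewrite lk lte_fin ltr_nat.
  by rewrite ltnS leqNgt kn.
have fP : P [set w | n%:R%:E < life M x i w] \is a fin_num by exact: fin_num_measure.
rewrite -(fineK fP) lee_fin leNgt; apply/negP.
(* If the probability were below p^n, the integer lifetimes in the interval from [n] (excluded) to
   [maxn n m] would already carry more mass than it, for [m] large. *)
rewrite -subr_gt0 => /(expr_lt_eps p01)[m /(_ (maxn n m))].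
rewrite leq_maxr => /(_ isT); rewrite ltNge => /negP; apply.
have [mA PA] := life_le_prob x i n.
have [mB PB] := life_le_prob x i (maxn n m).
rewrite lerBlDr -lerBlDl -lee_fin fineK //.
have -> : (p ^+ n - p ^+ maxn n m)%:E = P [set w | life_le x i (maxn n m) w]
     - P [set w | life_le x i n w].
  by rewrite PA PB -EFinB; congr (_%:E); ring.
rewrite leeBlDr; last by rewrite PA.
rewrite -measureU //; last first.
  apply/seteqP; split => // w [/= nl [k kn lk]]; move: nl; rewrite lk lte_fin ltr_nat.
  by rewrite ltnS leqNgt kn.
apply: le_measure; rewrite ?inE //; first exact: measurableU.
move=> w /= [k kn lk]; have [kn'|nk] := ltnP k n; [right; by exists k|left].
by rewrite /= lk lte_fin ltr_nat ltnS.
Qed.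

(** An infinite lifetime exceeds every [m], which has probability p^m, and p^m tends to 0. *)
Lemma life_finite x i : P.-negligible [set w | life M x i w = +oo].
Proof.
have ml : measurable [set w | life M x i w = +oo].
  exact/frog_events_measurable/(frog_events_life x i (emeasurable_set1 _)).
suff : P [set w | life M x i w = +oo] = 0 by move/negligibleP; exact.
have fP : P [set w | life M x i w = +oo] \is a fin_num by exact: fin_num_measure.
apply/eqP; rewrite -(fineK fP) eqe eq_le fine_ge0 // andbT leNgt; apply/negP.
move=> /(expr_lt_eps p01)[m /(_ m (leqnn m))]; rewrite ltNge => /negP; apply.
rewrite -lee_fin fineK // -(life_gt_prob x i m); apply: le_measure; rewrite ?inE //.
  exact/frog_events_measurable/(frog_events_life x i (measurable_ereal_gt _)).
by move=> w /= ->; rewrite ltry.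
Qed.

Hypothesis G : infinite_connected_graph e.

(** The nearest-neighbour trajectories starting at [x] carry total mass 1 by [sum_srw_path_prob]. *)
Lemma walk_prefix_walks N x i :
  P.-negligible [set w | walk_prefix N x i w \notin map (cons x) (walks e N x)].
Proof.
set B := [set w | walk_prefix N x i w \in map (cons x) (walks e N x)].
have uA : uniq (map (cons x) (walks e N x)).
  by rewrite map_inj_uniq ?walks_uniq // => s t [].
have mA a : measurable (setT `&` [set w | walk_prefix N x i w = a]).
  by rewrite setTI; exact: frog_events_measurable (@frog_events_walk_prefix N x i a).
have mB : measurable B.
  rewrite (_ : B = \big[setU/set0]_(a <- map (cons x) (walks e N x))
      (setT `&` [set w | walk_prefix N x i w = a])).
    by apply: bigsetU_measurable.
  rewrite -bigcup_seq; apply/seteqP; split => w /=.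
    by move=> h; exists (walk_prefix N x i w).
  by rewrite /B /= => -[a aA [_ /= ->]].
rewrite (_ : [set w | _] = ~` B); last first.
  by apply/seteqP; split => w /= /negP.
suff PB : P (~` B) = 0.
  by apply/negligibleP => //; exact: measurableC.
rewrite probability_setC // -(setTI B) measure_seq_partition // big_map.
rewrite (eq_big_seq (fun s => (srw_path_prob R e x s)%:E)) /=.
  by rewrite sumEFin (sum_srw_path_prob G) subee.
move=> s /(mem_walks G)[sN _].
by rewrite setTI -(walk_prefix_law x i) sN.
Qed.

(** The almost sure properties on which the pathwise arguments rely: particles die, start at their
    own site and move along edges. *)
Definition regular w := [/\ forall x i, life M x i w < +oo,
  forall x i, walk M x i 0 w = x &
  forall x i n, e (walk M x i n w) (walk M x i n.+1 w)].

Lemma regular_ae (root : V) : {ae P, forall w, regular w}.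
Proof.
have cVn : countable [set: V * nat * nat].
  have /countable_injP[f fi] := countable_vertices root G.
  apply/countable_injP; exists (fun z => choice.pickle (f z.1.1, z.1.2, z.2)).
  move=> [[x i] n] [[y j] m] _ _ /(pcan_inj choice.pickleK)[/= fxy -> ->].
  by rewrite (fi x y) ?inE.
have h : P.-negligible (\bigcup_z ([set w | life M z.1.1 z.1.2 w = +oo] `|`
    [set w | walk_prefix z.2 z.1.1 z.1.2 w \notin
      map (cons z.1.1) (walks e z.2 z.1.1)])).
  apply: negligible_countable_bigcup => // z.
  apply: negligibleU; first exact: life_finite.
  exact: walk_prefix_walks.
apply: negligibleS h => w /= nr; apply: contrapT => ng; apply: nr.
have pw n x i : walk_prefix n x i w \in map (cons x) (walks e n x).
  by apply: contrapT => /negP h; apply: ng; exists (x, i, n) => //; right.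
split=> [x i|x i|x i n].
- rewrite ltey; apply/eqP => lx; apply: ng.
  by exists (x, i, 0%N) => //; left.
- by have /mapP[s _ /(congr1 (head x))] := pw 0%N x i.
- have /mapP[s /(mem_walks G)[ss es] xs] := pw n.+1 x i.
  have wE k : (k <= n.+1)%N -> walk M x i k w = nth x (x :: s) k.
    by move=> kn; rewrite -xs nth_mkseq.
  rewrite !wE // 1?ltnW //; have /pathP := es; apply.
  by rewrite ss.
Qed.

End laws.

(** * Activation times and measurability of survival *)

Section measurable_predicates.
Context d (T : measurableType d).
Implicit Types A B : T -> Prop.

Lemma measurable_exists (U : Type) (A : U -> T -> Prop) : countable [set: U] ->
  (forall u, measurable [set w | A u w]) -> measurable [set w | exists u, A u w].
Proof.
move=> cU mA; rewrite (_ : [set w | _] = \bigcup_u [set w | A u w]).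
  exact: countable_bigcupT_measurable.
by apply/seteqP; split => w [u]; exists u.
Qed.

Lemma measurable_forall (U : Type) (A : U -> T -> Prop) : countable [set: U] ->
  (forall u, measurable [set w | A u w]) -> measurable [set w | forall u, A u w].
Proof.
move=> cU mA; rewrite (_ : [set w | _] = ~` [set w | exists u, ~ A u w]).
  by apply/measurableC/measurable_exists => // u; exact/measurableC/mA.
apply/seteqP; split => w /=; first by move=> Aw [u]; apply.
by move=> nA u; apply: contrapT => nAu; apply: nA; exists u.
Qed.

Lemma measurable_and A B : measurable [set w | A w] ->
  measurable [set w | B w] -> measurable [set w | A w /\ B w].
Proof. exact: measurableI. Qed.

Lemma measurable_and3 A B C : measurable [set w | A w] ->
  measurable [set w | B w] -> measurable [set w | C w] ->
  measurable [set w | [/\ A w, B w & C w]].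
Proof.
move=> mA mB mC; rewrite (_ : [set w | _] = [set w | A w /\ B w /\ C w]).
  by do 2 apply: measurable_and => //.
by apply/seteqP; split => w /= [Aw]; [|move=> []].
Qed.

Lemma measurable_not A : measurable [set w | A w] -> measurable [set w | ~ A w].
Proof. exact: measurableC. Qed.

Lemma measurable_cst_prop (Q : Prop) : measurable [set _ : T | Q].
Proof.
have [q|q] := pselect Q.
  by rewrite (_ : [set _ | _] = setT) //; apply/seteqP; split.
rewrite (_ : [set _ | _] = set0); first exact: measurable0.
by apply/seteqP; split.
Qed.

End measurable_predicates.

Section natural_times.
Variable R : realType.
Implicit Types (z : \bar R) (S : set (\bar R)).

(** All times of the dynamics have this form. Infima of such times are attained when finite, so
    comparing them with integers amounts to quantifying over integers. *)
Definition natural z := z = +oo \/ exists n : nat, z = n%:R%:E.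

Lemma natural_add z t : natural z -> natural t -> natural (z + t).
Proof.
move=> [->|[m ->]] [->|[n ->]]; [by left|by left|by left|right].
by exists (m + n)%N; rewrite natrD EFinD.
Qed.

Lemma ereal_inf_natural S : (forall z, S z -> natural z) ->
  ereal_inf S = +oo \/
  exists2 n : nat, S n%:R%:E & ereal_inf S = n%:R%:E.
Proof.
move=> nS; have [[n Sn]|nSn] := pselect (exists n : nat, S n%:R%:E); last first.
  left; apply/eqP; rewrite -leye_eq; apply: le_ereal_inf_tmp => z Sz.
  have [->//|[n zn]] := nS z Sz.
  by case: nSn; exists n; rewrite -zn.
have ex : exists n, `[< S n%:R%:E >] by exists n; apply/asboolP.
right; case: (ex_minnP ex) => m /asboolP Sm minm; exists m => //.
apply/eqP; rewrite eq_le; apply/andP; split; first exact: ereal_inf_lbound.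
apply: le_ereal_inf_tmp => z Sz; have [->|[k zk]] := nS z Sz; first by rewrite leey.
by rewrite zk lee_fin ler_nat; apply: minm; apply/asboolP; rewrite -zk.
Qed.

Lemma ereal_inf_natural_le S (n : nat) : (forall z, S z -> natural z) ->
  ereal_inf S <= n%:R%:E <-> exists2 m : nat, (m <= n)%N & S m%:R%:E.
Proof.
move=> nS; split.
  have [->|[m Sm ->]] := ereal_inf_natural nS; first by rewrite leye_eq.
  by rewrite lee_fin ler_nat; exists m.
by move=> [m mn Sm]; apply: ge_ereal_inf; exists m%:R%:E => //; rewrite lee_fin ler_nat.
Qed.

Lemma natural_add_le z t (n : nat) : natural z -> natural t ->
  z + t <= n%:R%:E <->
  exists m : nat, [/\ (m <= n)%N, z <= m%:R%:E & t <= (n - m)%:R%:E].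
Proof.
move=> [->|[i ->]] [->|[j ->]].
- by split => [|[m []]]; rewrite ?leye_eq.
- by split => [|[m []]]; rewrite ?leye_eq.
- by rewrite addey //; split => [|[m []]]; rewrite ?leye_eq.
rewrite -EFinD lee_fin -natrD ler_nat; split.
  by move=> ijn; exists i; rewrite !lee_fin !ler_nat; split => //; lia.
by move=> [m []]; rewrite !lee_fin !ler_nat; lia.
Qed.

(** An equality of times becomes a combination of upper bounds on [z], the form in which activation
    times are known to be measurable. The guard [n < m] is needed since the predecessor of 0 is
    0. *)
Lemma natural_add_eq z (n m : nat) : natural z ->
  z + n%:R%:E = m%:R%:E <->
  [/\ (n <= m)%N, z <= (m - n)%:R%:E &
      ~ ((n < m)%N /\ z <= (m - n).-1%:R%:E)].
Proof.
move=> [->|[i ->]]; first by split => [|[]]; rewrite ?leye_eq.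
rewrite !lee_fin !ler_nat -EFinD -natrD; split.
  by move=> [] /eqP; rewrite eqr_nat => /eqP <-; split; lia.
by move=> [nm inm h]; have -> : (i + n)%N = m by lia.
Qed.

End natural_times.

Section times.
Variables (R : realType) (V : choiceType) (e : rel V) (p : R) (root : V).
Variables (law : probability nat R) (d : measure_display).
Variables (T : measurableType d) (P : probability T R).
Variable M : frog_model e p law P.

(** Together with [path_within] and [activated_by], this unfolds upper bounds on times into
    quantifiers over countable types, from which measurability is immediate. *)
Definition reaches_within (w : T) (x y : V) (n : nat) :=
  exists i m : nat, [/\ (m <= n)%N, (i < Defs.eta M x w)%N,
    m%:R%:E < life M x i w & walk M x i m w = y].

Lemma natural_hitting_time w x y : natural (hitting_time M w x y).
Proof.
pose S := [set z : \bar R | exists i n : nat, [/\ (i < Defs.eta M x w)%N,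
  n%:R%:E < life M x i w, walk M x i n w = y & z = n%:R%:E]].
have nS z : S z -> natural z by move=> [i [n [_ _ _ ->]]]; right; exists n.
by have [|[n _]] := ereal_inf_natural nS; [left|right; exists n].
Qed.

Lemma hitting_time_le w x y n :
  hitting_time M w x y <= n%:R%:E <-> reaches_within w x y n.
Proof.
rewrite /hitting_time ereal_inf_natural_le; last first.
  by move=> z [i [m [_ _ _ ->]]]; right; exists m.
split.
  move=> [m mn [i [k [ix kl wy]]]] [] /eqP; rewrite eqr_nat => /eqP mk.
  by exists i, k; split => //; rewrite -mk.
by move=> [i [m [mn ix ml wy]]]; exists m => //; exists i, m.
Qed.

Fixpoint path_within (w : T) (x : V) (s : seq V) (n : nat) : Prop :=
  if s is y :: s'
  then exists m, [/\ (m <= n)%N, reaches_within w x y m &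
                     path_within w y s' (n - m)]
  else True.

Lemma natural_path_time w x s : natural (path_time M w x s).
Proof.
elim: s x => [|y s IH] x; first by right; exists 0%N.
exact: natural_add (natural_hitting_time _ _ _) (IH _).
Qed.

Lemma path_time_le w x s n :
  path_time M w x s <= n%:R%:E <-> path_within w x s n.
Proof.
elim: s x n => [|y s IH] x n; first by rewrite /= lee_fin ler0n.
rewrite /= natural_add_le; [|exact: natural_hitting_time|exact: natural_path_time].
by split => -[m [mn h1 h2]]; exists m; split => //;
  (exact/hitting_time_le || exact/IH).
Qed.

Definition activated_by (w : T) (x : V) (n : nat) :=
  exists s, last root s = x /\ path_within w root s n.

Lemma natural_activation_time w x : natural (activation_time M root w x).
Proof.
have nS z : [set path_time M w root s | s in [set s | last root s = x]] z ->
    natural z.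
  by move=> [s _ <-]; exact: natural_path_time.
by have [|[n _]] := ereal_inf_natural nS; [left|right; exists n].
Qed.

Lemma activation_time_le w x n :
  activation_time M root w x <= n%:R%:E <-> activated_by w x n.
Proof.
rewrite /activation_time ereal_inf_natural_le; last first.
  by move=> z [s _ <-]; exact: natural_path_time.
split.
  move=> [m mn [s ls st]]; exists s; split => //.
  by apply/path_time_le; rewrite st lee_fin ler_nat.
move=> [s [ls /path_time_le]].
have [->|[m sm]] := natural_path_time w root s; first by rewrite leye_eq.
by rewrite sm lee_fin ler_nat => mn; exists m => //; exists s.
Qed.

Hypothesis G : infinite_connected_graph e.

(** Survival is built from events about single particles by quantifying over vertices, vertex
    sequences and integers, all of which are countable. *)
Lemma survives_measurable : measurable (survives M root).
Proof.
have me x i : measurable [set w | (i < Defs.eta M x w)%N].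
  exact/frog_events_measurable/(frog_events_eta M x (fun n => i < n)%N).
have ml x i (n : nat) : measurable [set w | n%:R%:E < life M x i w].
  exact/frog_events_measurable/(frog_events_life M x i (measurable_ereal_gt _)).
have mr x y n : measurable [set w | reaches_within w x y n].
  apply: measurable_exists => // i; apply: measurable_exists => // m.
  rewrite (_ : [set w | _] = [set w | (m <= n)%N /\
    [/\ (i < Defs.eta M x w)%N, m%:R%:E < life M x i w & walk M x i m w = y]]).
    apply: measurable_and; first exact: measurable_cst_prop.
    by apply: measurable_and3 => //; exact: (walk_measurable M x i m [set y]).
  by apply/seteqP; split => w /=; [move=> []|move=> [? []]].
have mp s : forall x n, measurable [set w | path_within w x s n].
  elim: s => [|y s IH] x n; first exact: measurable_cst_prop.
  apply: measurable_exists => // m; apply: measurable_and3 => //.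
  exact: measurable_cst_prop.
have ma x n : measurable [set w | activated_by w x n].
  apply: measurable_exists; first exact: countable_vertex_seqs root G.
  by move=> s; apply: measurable_and => //; exact: measurable_cst_prop.
apply: measurable_forall => // m.
apply: measurable_exists; first exact: countable_vertices root G.
move=> x; apply: measurable_exists => // i; apply: measurable_exists => // n.
apply: measurable_and3 => //.
(* The activation time is [m - n] when [x] is activated by that time and not by the preceding
   one. *)
rewrite (_ : [set w | _] = [set w | [/\ (n <= m)%N, activated_by w x (m - n) &
    ~ ((n < m)%N /\ activated_by w x (m - n).-1)]]).
  apply: measurable_and3 => //; first exact: measurable_cst_prop.
  apply: measurable_not; apply: measurable_and => //.
  exact: measurable_cst_prop.
apply/seteqP; split => w /=.
  move=> /(natural_add_eq _ _ (natural_activation_time _ _))[nm h1 h2].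
  split => //; first exact/activation_time_le.
  by move=> [nm' h3]; apply: h2; split => //; exact/activation_time_le.
move=> [nm h1 h2]; apply/natural_add_eq; first exact: natural_activation_time.
split => //; first exact/activation_time_le.
by move=> [nm' h3]; apply: h2; split => //; exact/activation_time_le.
Qed.

End times.

(** * Survival and chains of visits *)

(** The integers from 1 to [N] that satisfy a decreasing predicate form an initial segment, so their
    number is also the largest of them. *)
Lemma count_iota_decreasing (a : pred nat) N n :
  (forall i j, (i <= j)%N -> a j -> a i) -> (0 < n)%N ->
  (n <= count a (iota 1 N))%N = (n <= N)%N && a n.
Proof.
move=> adec; elim: N n => [|N IH] n n0; first by rewrite leqNgt n0.
rewrite -[in LHS](addn1 N) iotaD count_cat /= add1n addn0.
have [aN|naN] := boolP (a N.+1).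
  have -> : count a (iota 1 N) = N.
    apply/eqP; rewrite eqn_leq -{2}(size_iota 1 N) count_size /=.
    case: N IH aN => [|N] // IH aN.
    by rewrite IH // leqnn; apply: adec aN.
  rewrite /= addn1; case: (leqP n N.+1) => //= nN.
  by rewrite (adec _ _ nN).
rewrite addn0 IH // [in RHS]leq_eqVlt ltnS.
by have [->|_] := eqVneq n N.+1; rewrite //= (negbTE naN) andbF.
Qed.

(** The largest age at most [N] at which a particle of lifetime [z] is alive. A count takes finitely
    many values whatever the extended real [z] is. *)
Definition steps_survived (R : realType) (N : nat) (z : \bar R) : nat :=
  count (fun n => n%:R%:E < z) (iota 1 N).

Lemma steps_survived_ge (R : realType) N (z : \bar R) n : (0 < n)%N ->
  (n <= steps_survived N z)%N = (n <= N)%N && (n%:R%:E < z).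
Proof.
move=> n0; apply: count_iota_decreasing => // i j ij.
by apply: le_lt_trans; rewrite lee_fin ler_nat.
Qed.

Lemma steps_survived_le (R : realType) N (z : \bar R) :
  (steps_survived N z <= N)%N.
Proof. by rewrite -[leqRHS](size_iota 1 N) count_size. Qed.

Section chains.
Variables (V : choiceType) (e : rel V) (root : V).

(* A triple [(w, l, b)] records the trajectory of a particle, the last age at
   which it is alive and whether it exists at all. *)
Definition visited (a : seq V * nat * bool) : seq V :=
  if a.2 then take a.1.2 (behead a.1.1) else [::].

(** The ball makes this depend on finitely many coordinates of [c]. Distinctness of the sites makes
    the particles used along a chain independent, and bounds the length of chains inside a finite
    set. *)
Definition chain (N k : nat) (c : V -> seq V * nat * bool) : Prop :=
  exists s : seq V, [/\ size s = k, uniq (root :: s), {subset s <= ball e root N} &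
    path (fun x y => y \in visited (c x)) root s].

End chains.

Section survival_chains.
Variables (R : realType) (V : choiceType) (e : rel V) (p : R) (root : V).
Variables (law : probability nat R) (d : measure_display).
Variables (T : measurableType d) (P : probability T R).
Variable M : frog_model e p law P.
Hypothesis G : infinite_connected_graph e.

Definition first_particle (N : nat) (x : V) (w : T) : seq V * nat * bool :=
  (walk_prefix M N x 0 w, steps_survived N (life M x 0 w), (0 < Defs.eta M x w)%N).

Definition visits (w : T) (x y : V) (n : nat) : Prop :=
  [/\ (0 < n)%N, (0 < Defs.eta M x w)%N, n%:R%:E < life M x 0 w
    & walk M x 0 n w = y].

Lemma visited_first_particle N x y w :
  (y \in visited (first_particle N x w)) <->
  exists2 n, (n <= N)%N & visits w x y n.
Proof.
rewrite /visited /first_particle /=; case: ifP => [ex|ex]; last first.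
  by split => // -[n _ []]; rewrite ex.
rewrite /walk_prefix /mkseq /= -map_take take_iota.
rewrite (minn_idPl (steps_survived_le _ _)); split.
  move=> /mapP[n]; rewrite mem_iota add1n ltnS => /andP[n0].
  by rewrite steps_survived_ge // => /andP[nN nl] ->; exists n.
move=> [n nN [n0 _ nl <-]]; apply/mapP; exists n => //.
by rewrite mem_iota add1n ltnS n0 steps_survived_ge // nN.
Qed.

Definition chain_event (N k : nat) : set T :=
  [set w | chain e root N k (fun x => first_particle N x w)].

(** The truncation disappears in the union over [N]: a finite sequence of sites lies in some ball,
    and its visits use finitely many ages. *)
Lemma chain_eventP k w : (exists N, chain_event N k w) <->
  exists s : seq V, [/\ size s = k, uniq (root :: s) &
    path (fun x y => `[< exists n, visits w x y n >]) root s].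
Proof.
split.
  move=> [N [s [sk us _ ps]]]; exists s; split => //.
  apply: sub_path ps => x y /visited_first_particle[n _ vn].
  by apply/asboolP; exists n.
move=> [s [sk us ps]].
suff [N hN] : exists N, path (fun x y =>
    `[< exists2 n, (n <= N)%N & visits w x y n >]) root s.
  have [N' sN'] := ball_all root G s.
  exists (maxn N N'), s; split => //.
    by move=> x /sN'; apply: ball_sub; exact: leq_maxr.
  apply: sub_path hN => x y /asboolP[n nN vn].
  apply/visited_first_particle; exists n => //.
  exact: leq_trans nN (leq_maxl _ _).
elim: s root {sk us} ps => [|y s IH] x /=; first by exists 0%N.
move=> /andP[/asboolP[n vn] /IH[N pN]]; exists (maxn n N).
apply/andP; split; first by apply/asboolP; exists n => //; exact: leq_maxl.
apply: sub_path pN => u v /asboolP[m mN vm]; apply/asboolP; exists m => //.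
exact: leq_trans mN (leq_maxr _ _).
Qed.

Lemma chain_event_nondecreasing k : nondecreasing_seq (chain_event ^~ k).
Proof.
move=> N N' NN'; apply/subsetPset => w [s [sk us sN ps]].
exists s; split => //; first by move=> x /sN; apply: ball_sub.
apply: sub_path ps => x y /visited_first_particle[n nN vn].
by apply/visited_first_particle; exists n => //; exact: leq_trans nN NN'.
Qed.

Lemma chain_event_nonincreasing N k : chain_event N k.+1 `<=` chain_event N k.
Proof.
move=> w [s [sk us sN ps]].
case/lastP: s sk us sN ps => // s y; rewrite size_rcons => -[sk].
rewrite -rcons_cons rcons_uniq rcons_path => /andP[_ us] sN /andP[ps _].
by exists s; split => // x xs; apply: sN; rewrite mem_rcons inE xs orbT.
Qed.

Section realisation.
Variable w : T.
Hypothesis reg : regular M w.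

(** Particles move by one edge per unit of time, so activation spreads at speed at most one. *)
Lemma reaches_within_ball x y j n : x \in ball e root j ->
  reaches_within M w x y n -> y \in ball e root (j + n).
Proof.
move=> xj [i [m [mn _ _ <-]]]; have [_ w0 wS] := reg.
apply: (@ball_sub _ _ _ (j + m)); first by rewrite leq_add2l.
elim: m {mn} => [|m IH]; first by rewrite addn0 w0.
by rewrite addnS; apply: ball_step (wS x i m).
Qed.

Lemma path_within_ball x s j n : x \in ball e root j ->
  path_within M w x s n -> last x s \in ball e root (j + n).
Proof.
elim: s x j n => [|y s IH] x j n xj /=.
  by move=> _; apply: ball_sub xj; exact: leq_addr.
move=> [m [mn xy ps]]; rewrite -(subnKC mn) addnA; apply: IH => //.
exact: reaches_within_ball xy.
Qed.

Lemma path_within_rcons x s y k n : path_within M w x s k ->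
  reaches_within M w (last x s) y n -> path_within M w x (rcons s y) (k + n).
Proof.
elim: s x k => [|z s IH] x k /=.
  move=> _ [i [m [mn h1 h2 h3]]]; exists (k + n)%N; split => //.
  by exists i, m; split => //; rewrite (leq_trans mn) ?leq_addl.
move=> [m [mk xz ps]] zy; exists m; split => //.
  by rewrite (leq_trans mk) ?leq_addr.
by rewrite addnC -addnBA // addnC; exact: IH.
Qed.

Lemma activated_by_mono x m n : (m <= n)%N -> activated_by root M w x m ->
  activated_by root M w x n.
Proof.
move=> mn /activation_time_le h; apply/activation_time_le.
by apply: le_trans h _; rewrite lee_fin ler_nat.
Qed.

(* If no particle is active at time [m], activation cannot cross time [m]: a
   particle activated at time at most [m] that reaches a site after time [m] is
   active at time [m]. Every site of every chain is then within [m] of the root. *)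
Lemma chains_survive :
  (forall k, exists N, chain_event N k w) -> survives M root w.
Proof.
move=> hk m; apply: contrapT => nact.
have step x y n : activated_by root M w x m -> visits w x y n ->
    activated_by root M w y m.
  move=> xm [n0 ex nl wy].
  have [xoo|[k xk]] := natural_activation_time root M w x.
    by move/activation_time_le: xm; rewrite xoo leye_eq.
  have km : (k <= m)%N.
    by move/activation_time_le: xm; rewrite xk lee_fin ler_nat.
  have [knm|knm] := leqP (k + n) m.
    apply: activated_by_mono knm _.
    have /activation_time_le[s [ls ps]] : activation_time M root w x <= k%:R%:E.
      by rewrite xk.
    exists (rcons s y); rewrite last_rcons; split => //.
    by apply: path_within_rcons => //; rewrite ls; exists 0%N, n.
  (* Here [k <= m < k + n]: at time [m] the particle has age [m - k], less than [n], and is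
     alive. *)
  case: nact; exists x, 0%N, (m - k)%N; split => //.
    by apply: le_lt_trans nl; rewrite lee_fin ler_nat; lia.
  by rewrite xk -EFinD -natrD subnKC.
(* With [k] the size of the ball, a chain has [k + 1] distinct sites, one more than the ball can
   hold. *)
have [s [sk us ps]] := (chain_eventP _ _).1 (hk (size (ball e root m))).
have sm : {subset root :: s <= ball e root m}.
  have rm : activated_by root M w root m by exists [::].
  have act : forall s x, activated_by root M w x m ->
      path (fun x y => `[< exists n, visits w x y n >]) x s ->
      forall z, z \in x :: s -> activated_by root M w z m.
    elim=> [|y t IH] x xm /=; first by move=> _ z; rewrite inE => /eqP ->.
    move=> /andP[/asboolP[n xy] pt] z; rewrite inE => /predU1P[-> //|].
    by apply: IH => //; exact: step xy.
  move=> x /(act _ _ rm ps)[t [<- pt]]; rewrite -[m in ball _ _ m]add0n.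
  by apply: path_within_ball => //; exact: root_ball.
by have := uniq_leq_size us sm; rewrite /= sk ltnn.
Qed.

(* Without a chain of length [k], every activated site is less than [k] visits
   away from the root, and each particle visits finitely many sites. *)
Lemma survive_chains : (forall x, (Defs.eta M x w <= 1)%N) ->
  survives M root w -> forall k, exists N, chain_event N k w.
Proof.
move=> e1 surv k; apply: contrapT => /chain_eventP nch.
have [lfin w0 _] := reg.
have /choice[b hb] x : exists b, forall n : nat,
    n%:R%:E < life M x 0 w -> (n < b)%N.
  have := lfin x 0%N; case: (life M x 0 w) => [r _||]; last by exists 0%N.
    exists (Num.bound `|r|%R) => n; rewrite lte_fin => nr.
    rewrite -(ltr_nat R) (lt_trans nr) //.
    by rewrite (le_lt_trans (ler_norm r)) // archi_boundP.
  by rewrite ltxx.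
pose v x y := `[< exists n, visits w x y n >].
have vP x y : reflect (exists n, visits w x y n) (v x y) by exact: asboolP.
(* [lev j] is a finite list containing every site reached from the root by [j] visits; [b x] bounds
   the ages at which the particle of [x] is alive. *)
pose lev := fix lev j := if j is j'.+1
  then flatten [seq [seq walk M x 0 n w | n <- iota 0 (b x)] | x <- lev j']
  else [:: root].
have levP : forall s x j, x \in lev j -> path v x s -> last x s \in lev (j + size s)%N.
  elim=> [|y s IH] x j xj /=; first by rewrite addn0.
  move=> /andP[/vP[n [_ _ nl wy]] ps]; rewrite addnS -addSn; apply: IH => //.
  apply/flattenP; exists [seq walk M x 0 n w | n <- iota 0 (b x)].
    exact: (map_f (fun x => [seq walk M x 0 n w | n <- iota 0 (b x)])).
  by apply/mapP; exists n => //; rewrite mem_iota /= add0n; exact: hb.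
pose L := flatten [seq lev j | j <- iota 0 k].
have pathv x s n : path_within M w x s n ->
    exists2 s', path v x s' & last x s' = last x s.
  elim: s x n => [|y s IH] x n /=; first by exists [::].
  move=> [m [_ [i [j [_ ix jl wy]]] /IH[s' ps' ls']]].
  have i0 : i = 0%N by have := leq_trans ix (e1 x); case: (i).
  (* At age 0 the particle is still at [x], so [y] is [x] and the repetition is dropped. *)
  have [j0|j0] := posnP j.
    by exists s'; move: wy; rewrite j0 w0 => ->.
  exists (y :: s') => //=; rewrite ps' andbT.
  apply/vP; exists j; split => //; first by rewrite -[X in (X < _)%N]i0.
    by rewrite -i0.
  by rewrite -i0.
have actL x n : activated_by root M w x n -> x \in L.
  move=> [s [<- /pathv[s' ps' <-]]].
  (* Loops are removed. If [k] or more visits remained, the first [k] of them would form a chain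
     that [nch] excludes. *)
  case/shortenP: ps' => t pt ut _.
  have [tk|kt] := ltnP (size t) k.
    apply/flattenP; exists (lev (size t)).
      by apply: map_f; rewrite mem_iota.
    by rewrite -[size t]add0n; apply: levP => //=; rewrite inE.
  case: nch; exists (take k t); split.
  - by rewrite size_takel.
  - by rewrite -[_ :: _]/(take k.+1 (root :: t)) take_uniq.
  - by have := take_path k pt.
have /choice[B hB] x : exists B, forall n m : nat, n%:R%:E < life M x 0 w ->
    activation_time M root w x + n%:R%:E = m%:R%:E -> (m < B)%N.
  have [xoo|[t xt]] := natural_activation_time root M w x.
    by exists 0%N => n m; rewrite xoo addye.
  exists (t + b x)%N => n m /hb nb; rewrite xt -EFinD -natrD => -[/eqP].
  by rewrite eqr_nat => /eqP <-; rewrite ltn_add2l.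
(* Activity of the particle of [x] stops before [B x], and every activated site is in [L]; the sum
   over [L] is thus a time at which no particle is active. *)
have [x [i [n [ix nl xm]]]] := surv (\sum_(x <- L) B x)%N.
have i0 : i = 0%N by have := leq_trans ix (e1 x); case: (i).
rewrite i0 in nl.
have xL : x \in L.
  have [xoo|[t xt]] := natural_activation_time root M w x.
    by move: xm; rewrite xoo addye.
  by apply: (actL x t); apply/activation_time_le; rewrite xt.
have := hB _ _ _ nl xm; rewrite ltnNge => /negP; apply.
by rewrite (perm_big _ (perm_to_rem xL)) /= big_cons leq_addr.
Qed.

End realisation.

End survival_chains.

(** * Independence of the sites *)

Section site_independence.
Variables (R : realType) (V : choiceType) (e : rel V) (p : R).
Variables (law : probability nat R) (d : measure_display).
Variables (T : measurableType d) (P : probability T R).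
Variable M : frog_model e p law P.

Let events : frog_index V -> set (set T) :=
  frog_events (fun x => Defs.eta M x : T -> nat) (walk M)
    (fun x i => life M x i : T -> \bar R).

(** [frog_independent] treats presence, trajectory and lifetime as separate indices; listing the
    three indices of each site of [s] gives independence both across sites and within a site. *)
Lemma site_independent (s : seq V) (A B C : V -> set T) : uniq s ->
  (forall x, events (inl (inl x)) (A x)) ->
  (forall x, events (inl (inr (x, 0%N))) (B x)) ->
  (forall x, events (inr (x, 0%N)) (C x)) ->
  P (\bigcap_(x in [set` s]) (A x `&` B x `&` C x)) =
  \prod_(x <- s) (P (A x) * P (B x) * P (C x)).
Proof.
move=> us eA eB eC.
pose ks : seq (frog_index V) := [seq inl (inl x) | x <- s] ++
  [seq inl (inr (x, 0%N)) | x <- s] ++ [seq inr (x, 0%N) | x <- s].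
pose F (k : frog_index V) := match k with
  | inl (inl x) => A x | inl (inr (x, _)) => B x | inr (x, _) => C x end.
have uks : uniq ks.
  rewrite !cat_uniq !map_inj_uniq ?us //= ?andbT; try by move=> x y [].
  apply/andP; split.
    by apply/hasPn => k; rewrite mem_cat => /orP[] /mapP[x _ ->]; apply/negP => /mapP[].
  by apply/hasPn => k /mapP[x _ ->]; apply/negP => /mapP[].
have inJ k : (k \in seq_fset tt ks) = (k \in ks) by rewrite seq_fsetE.
have eF k : k \in seq_fset tt ks -> events k (F k).
  by rewrite inJ /ks !mem_cat => /or3P[] /mapP[x _ ->];
    [exact: eA|exact: eB|exact: eC].
have -> : \bigcap_(x in [set` s]) (A x `&` B x `&` C x) =
    \bigcap_(k in [set` seq_fset tt ks]) F k.
  apply/seteqP; split => w /=.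
    move=> h k /=; rewrite inJ /ks !mem_cat => /or3P[] /mapP[x xs ->] /=;
    by have [[]] := h _ xs.
  move=> h x xs; split; [split|].
  - by apply: (h (inl (inl x))); rewrite /= inJ /ks !mem_cat map_f.
  - apply: (h (inl (inr (x, 0%N)))); rewrite /= inJ /ks !mem_cat.
    by rewrite (map_f (fun x => inl (inr (x, 0%N)) : frog_index V)) ?orbT.
  - apply: (h (inr (x, 0%N))); rewrite /= inJ /ks !mem_cat.
    by rewrite (map_f (fun x => inr (x, 0%N) : frog_index V)) ?orbT.
rewrite (frog_independent eF) (perm_big ks) /=; last first.
  exact: uniq_perm.
by rewrite !big_cat !big_map !big_split /= muleA.
Qed.

End site_independence.

(** * Expectations over finitely many sites and stochastic domination *)

Section finite_expectation.
Variables (R : realType) (I C : choiceType) (A : I -> seq C).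

Definition update (c : I -> C) (x : I) (a : C) : I -> C :=
  fun y => if y == x then a else c y.

(* Expectation of [f] at the configuration obtained from [c] by resampling the
   coordinates in [s] independently, with weights [mu x] on [A x]. *)
Fixpoint expectation (mu : I -> C -> R) (s : seq I) (f : (I -> C) -> R)
    (c : I -> C) : R :=
  if s is x :: s'
  then (\sum_(a <- A x) mu x a * expectation mu s' f (update c x a))%R
  else f c.

Section domination.
Variables (le : C -> C -> Prop) (f : (I -> C) -> R).
Hypothesis le_refl : forall a, le a a.
Hypothesis f_mono :
  forall c c', (forall x, le (c x) (c' x)) -> (f c <= f c')%R.

Lemma expectation_mono (mu : I -> C -> R) s c c' :
  (forall x a, (0 <= mu x a)%R) -> (forall x, le (c x) (c' x)) ->
  (expectation mu s f c <= expectation mu s f c')%R.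
Proof.
move=> mu0; elim: s c c' => [|x s IH] c c' cc' /=; first exact: f_mono.
apply: ler_sum => a _; apply: ler_wpM2l => //; apply: IH => y.
by rewrite /update; case: ifP.
Qed.

(** The weights are exchanged one coordinate at a time: after the exchange in the other coordinates,
    the expectation of [f] is still increasing in the value at [x], so the one-site hypothesis
    applies to it. *)
Lemma expectation_dominated (mu mu' : I -> C -> R) s c :
  (forall x a, (0 <= mu x a)%R) -> (forall x a, (0 <= mu' x a)%R) ->
  (forall x (h : C -> R), (forall a b, le a b -> (h a <= h b)%R) ->
    (\sum_(a <- A x) mu' x a * h a <= \sum_(a <- A x) mu x a * h a)%R) ->
  (expectation mu' s f c <= expectation mu s f c)%R.
Proof.
move=> mu0 mu'0 dom; elim: s c => [|x s IH] c //=.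
apply: (@le_trans _ _ (\sum_(a <- A x) mu' x a * expectation mu s f (update c x a))%R).
  by apply: ler_sum => a _; apply: ler_wpM2l.
apply: dom => a b ab; apply: expectation_mono => // y.
by rewrite /update; case: ifP.
Qed.

End domination.

Section probability.
Variables (d : measure_display) (T : measurableType d) (P : probability T R).
Variables (X : I -> T -> C) (mu : I -> C -> R) (g : (I -> C) -> Prop).

Definition resample (s : seq I) (c c' : I -> C) : I -> C :=
  fun x => if x \in s then c' x else c x.

Hypothesis A_uniq : forall x, uniq (A x).
Hypothesis X_measurable : forall x a, measurable [set w | X x w = a].
Hypothesis X_independent : forall s c, uniq s ->
  (forall x, x \in s -> c x \in A x) ->
  P (\bigcap_(x in [set` s]) [set w | X x w = c x]) =
  (\prod_(x <- s) mu x (c x))%:E.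
Hypothesis X_support : forall x, P [set w | X x w \in A x] = 1.
Hypothesis g_measurable : forall s c,
  measurable [set w | g (resample s c (X ^~ w))].

Lemma probability_expectation s c : uniq s ->
  P [set w | g (resample s c (X ^~ w))] =
  (expectation mu s (fun c => (`[< g c >])%:R) c)%:E.
Proof.
pose f c : R := (`[< g c >])%:R%R.
pose D (s0 : seq I) (c : I -> C) := \bigcap_(x in [set` s0]) [set w | X x w = c x].
have mD s0 c' : measurable (D s0 c').
  by rewrite /D bigcap_seq; apply: bigsetI_measurable.
(* The induction carries the event that the coordinates already treated take the values of [c].
   Independence is then used only once, when no coordinate remains. *)
suff main s0 : uniq (s0 ++ s) -> (forall x, x \in s0 -> c x \in A x) ->
    P (D s0 c `&` [set w | g (resample s c (X ^~ w))]) = ((\prod_(x <- s0) mu x (c x)) * expectation mu s f c)%:E.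
  move=> us; have := main [::] us; rewrite big_nil mul1r => <- //; congr (P _).
  by apply/seteqP; split => w //= [].
elim: s s0 c => [|x s IH] s0 c us cA /=.
  rewrite cats0 in us.
  have res w : resample [::] c (X ^~ w) = c by apply/funext => x; rewrite /resample in_nil.
  have [gc|ngc] := pselect (g c).
    rewrite /f asboolT // mulr1 -X_independent //; congr (P _).
    by apply/seteqP; split => w /=; [move=> []|move=> h; split => //; rewrite res].
  rewrite /f asboolF // mulr0 (_ : _ `&` _ = set0) ?measure0 //.
  by apply/seteqP; split => // w /= []; rewrite res.
have us' : uniq ((x :: s0) ++ s).
  by rewrite -(perm_uniq (permEl (perm_catCA s0 [:: x] s))).
have xs0 : x \notin s0 by move: us' => /= /andP[]; rewrite mem_cat negb_or => /andP[].
set B := _ `&` _; have mB : measurable B by apply: measurableI.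
have mXA : measurable [set w | X x w \in A x].
  rewrite (_ : [set w | _] = \big[setU/set0]_(a <- A x) [set w | X x w = a]).
    exact: bigsetU_measurable.
  rewrite -bigcup_seq; apply/seteqP; split => w /=.
    by move=> xa; exists (X x w).
  by move=> [a /= aA xa]; rewrite xa.
have PAC : P (~` [set w | X x w \in A x]) = 0.
  by rewrite probability_setC // X_support subee.
(* Values outside the finite list [A x] have probability 0, so the event may be split according to
   the values in [A x]. *)
have -> : P B = P (B `&` [set w | X x w \in A x]).
  apply/eqP; rewrite eq_le; apply/andP; split; last first.
    exact: measureIl.
  rewrite -[leRHS]adde0 -[X in _ + X](_ : P (B `\` [set w | X x w \in A x]) = 0).
    rewrite -measureU //; [|exact: measurableI|exact: measurableD|].
      by rewrite setUIDK.
    by rewrite setIDA setIAC -setIA setDE -!setIA setICr !setI0.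
  apply: (@subset_measure0 _ _ _ _ _ (~` [set w | X x w \in A x])).
  - exact: measurableD.
  - exact: measurableC.
  - by move=> w [].
  - exact: PAC.
rewrite measure_seq_partition //; last by move=> a _; apply: measurableI.
rewrite big_distrr /= -sumEFin; apply: eq_big_seq => a aA.
rewrite (_ : B `&` _ = D (x :: s0) (update c x a) `&`
    [set w | g (resample s (update c x a) (X ^~ w))]).
  rewrite IH //; last first.
    move=> y; rewrite inE /update; have [-> //|_] := eqVneq y x; exact: cA.
  rewrite big_cons {1}/update eqxx mulrCA mulrA; congr (_ * _ * _)%:E.
  apply: eq_big_seq => y ys0; rewrite /update.
  by have [yx|//] := eqVneq y x; rewrite -yx ys0 in xs0.
have rE w : X x w = a ->
    resample (x :: s) c (X ^~ w) = resample s (update c x a) (X ^~ w).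
  move=> xa; apply/funext => y; rewrite /resample /update inE.
  by have [->|] := eqVneq y x => //=; rewrite xa; case: ifP.
apply/seteqP; split => w /=.
  move=> [[Dw gw] xa]; rewrite -rE //; split => // y /=; rewrite inE /update.
  have [->|yx] //= := eqVneq y x; exact: Dw.
move=> [Dw gw]; have xa : X x w = a.
  by have := Dw x; rewrite /= inE eqxx /update eqxx => /(_ isT).
split => //; split; last by rewrite /= rE.
move=> y /= ys0.
have := Dw y; rewrite /= inE ys0 orbT /update => /(_ isT).
by have [yx|//] := eqVneq y x; rewrite -yx ys0 in xs0.
Qed.

End probability.
End finite_expectation.

(** * Expected number of chains *)

Lemma measure_bigsetU_le (R : realType) d (T : measurableType d)
    (mu : {measure set T -> \bar R}) (I : Type) (s : seq I) (F : I -> set T) :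
  (forall i, measurable (F i)) ->
  mu (\big[setU/set0]_(i <- s) F i) <= \sum_(i <- s) mu (F i).
Proof.
move=> mF; elim: s => [|i s IH]; first by rewrite !big_nil measure0.
rewrite !big_cons; apply: le_trans (measureU2 _ _ _) _ => //.
  exact: bigsetU_measurable.
exact: leeD2l.
Qed.

Section zero_one_model.
Variables (R : realType) (V : choiceType) (e : rel V) (p q : R) (root : V).
Variables (law : probability nat R) (d : measure_display).
Variables (T : measurableType d) (P : probability T R).
Variable M : frog_model e p law P.
Hypothesis G : infinite_connected_graph e.
Hypothesis p01 : (0 <= p < 1)%R.
Hypothesis law1 : law [set 1%N] = q%:E.
Hypothesis law0 : law [set 0%N] = (1 - q)%:E.

Lemma eta_gt0_measurable x : measurable [set w | (0 < Defs.eta M x w)%N].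
Proof. exact/frog_events_measurable/(frog_events_eta M x (fun n => 0 < n)%N). Qed.

Lemma eta_gt0_prob x : P [set w | (0 < Defs.eta M x w)%N] = q%:E.
Proof.
have lawC : law (~` [set 0%N]) = q%:E.
  by rewrite probability_setC // law0 -EFinB subKr.
rewrite -lawC -(eta_law M x); congr (P _); apply/seteqP; split => w /=.
  by rewrite lt0n => /eqP.
by move=> /eqP; rewrite lt0n.
Qed.

Lemma eta_le1_ae : {ae P, forall w, forall x, (Defs.eta M x w <= 1)%N}.
Proof.
have h x : P.-negligible [set w | ~ (Defs.eta M x w <= 1)%N].
  have mA : measurable [set w | ~ (Defs.eta M x w <= 1)%N].
    exact/frog_events_measurable/(frog_events_eta M x (fun n => ~ (n <= 1)%N)).
  suff PA : P [set w | ~ (Defs.eta M x w <= 1)%N] = 0 by apply/negligibleP.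
  have lawC : law (~` ([set 0%N] `|` [set 1%N])) = 0.
    have lawU : law ([set 0%N] `|` [set 1%N]) = 1.
      rewrite measureU //; last by apply/seteqP; split => // -[|[|n]] [].
      transitivity ((1 - q)%:E + q%:E); last by rewrite -EFinD subrK.
      by congr (_ + _); [exact: law0|exact: law1].
    by rewrite probability_setC // lawU subee.
  rewrite -lawC -(eta_law M x).
  congr (P _); apply/seteqP; split => w /=.
    by move=> /negP; case: (Defs.eta M x w) => [|[|n]] // _ [].
  by case: (Defs.eta M x w) => [|[|n]] // h; case: h; [left|right].
have := negligible_countable_bigcup (countable_vertices root G) h.
by apply: negligibleS => w /= /existsNP[x nx]; exists x.
Qed.

Lemma survives_iff_chains_ae : {ae P, forall w,
  survives M root w <-> forall k, exists N, chain_event root M N k w}.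
Proof.
have h := regular_ae M p01 G root.
apply: filterS2 h eta_le1_ae => w reg e1; split.
  exact: survive_chains.
exact: chains_survive.
Qed.

Lemma visits_measurable x y n : measurable [set w | visits M w x y n].
Proof.
rewrite (_ : [set w | _] = [set w | (0 < n)%N /\
    [/\ (0 < Defs.eta M x w)%N, n%:R%:E < life M x 0 w & walk M x 0 n w = y]]).
  apply: measurable_and; first exact: measurable_cst_prop.
  apply: measurable_and3; first exact: eta_gt0_measurable.
    exact/frog_events_measurable/(frog_events_life M x 0%N (measurable_ereal_gt _)).
  exact: (walk_measurable M x 0 n [set y]).
by apply/seteqP; split => w /=; [move=> []|move=> [? []]].
Qed.

Lemma visited_measurable N x y :
  measurable [set w | y \in visited (first_particle M N x w)].
Proof.
rewrite (_ : [set w | _] = [set w | exists n, (n <= N)%N /\ visits M w x y n]).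
  apply: measurable_exists => // n; apply: measurable_and.
    exact: measurable_cst_prop.
  exact: visits_measurable.
by apply/seteqP; split => w /=; [move=> /visited_first_particle[n]; exists n
  |move=> [n [nN vn]]; apply/visited_first_particle; exists n].
Qed.

(** Stated for an arbitrary random configuration, because it also serves for configurations of which
    only some coordinates are resampled. *)
Lemma chain_measurable (N k : nat) (c : T -> V -> seq V * nat * bool) :
  (forall x y, measurable [set w | y \in visited (c w x)]) ->
  measurable [set w | chain e root N k (c w)].
Proof.
move=> mc; apply: measurable_exists; first exact: countable_vertex_seqs root G.
move=> s; rewrite (_ : [set w | _] = [set w |
    ([/\ size s = k, uniq (root :: s) & {subset s <= ball e root N}]) /\
    path (fun x y => y \in visited (c w x)) root s]); last first.
  by apply/seteqP; split => w /=; [move=> []|move=> [[]]].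
apply: measurable_and; first exact: measurable_cst_prop.
elim: s root => [|y s IH] x /=; first exact: measurable_cst_prop.
rewrite (_ : [set w | _] = [set w | y \in visited (c w x) /\
    path (fun x y => y \in visited (c w x)) y s]).
  exact: measurable_and.
by apply/seteqP; split => w /=; [move=> /andP|move/andP].
Qed.

Lemma chain_event_measurable N k : measurable (chain_event root M N k).
Proof. by apply: chain_measurable => x y; exact: visited_measurable. Qed.

Section extinction.

(** A pair [(n, y)] stands for a visit to [y] at age [n]. Recording the ages decomposes a chain into
    events whose probabilities multiply. *)
Let hop_prob (x : V) (h : nat * V) : R :=
  (q * p ^+ h.1 * fine (P [set w | walk M x 0 h.1 w = h.2]))%R.

Fixpoint hops (w : T) (x : V) (t : seq (nat * V)) : Prop :=
  if t is h :: t' then visits M w x h.2 h.1 /\ hops w h.2 t' else True.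

Fixpoint hops_weight (x : V) (t : seq (nat * V)) : R :=
  (if t is h :: t' then hop_prob x h * hops_weight h.2 t' else 1)%R.

Fixpoint hop_seqs (N k : nat) : seq (seq (nat * V)) :=
  if k is k'.+1 then
    [seq h :: t | h <- [seq (n, y) | n <- iota 1 N, y <- ball e root N],
                  t <- hop_seqs N k']
  else [:: [::]].

Lemma hops_measurable x t : measurable [set w | hops w x t].
Proof.
elim: t x => [|h t IH] x; first exact: measurable_cst_prop.
by apply: measurable_and; [exact: visits_measurable|exact: IH].
Qed.

Let walk_at_measurable x n y : measurable [set w | walk M x 0 n w = y].
Proof. exact: (walk_measurable M x 0 n [set y]). Qed.

(** Since the sites are distinct, the hop leaving a site is a function [h] of that site. The event
    is therefore contained in an intersection over the departure sites, which are all sites but the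
    last, and [site_independent] applies. *)
Lemma hops_prob x t : uniq (x :: unzip2 t) ->
  P [set w | hops w x t] <= (hops_weight x t)%:E.
Proof.
move=> uxt.
have [h ht] : exists h, t = [seq h z | z <- belast x (unzip2 t)].
  elim: t x uxt => [|[n y] t IH] x /=; first by exists (fun=> (0%N, x)).
  move=> /andP[xyt /IH[h ht]]; exists (fun z => if z == x then (n, y) else h z).
  rewrite eqxx; congr cons; rewrite {1}ht; apply/eq_in_map => z zt.
  by have [zx|//] := eqVneq z x; rewrite -zx (mem_belast zt) in xyt.
pose A x := [set w | (0 < Defs.eta M x w)%N].
pose B x := [set w | walk M x 0 (h x).1 w = (h x).2].
pose C x := [set w | (h x).1%:R%:E < life M x 0 w].
have ubelast : uniq (belast x (unzip2 t)).
  by apply: subseq_uniq uxt; rewrite lastI -cats1; exact: prefix_subseq.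
have PABC : P (\bigcap_(z in [set` belast x (unzip2 t)]) (A z `&` B z `&` C z)) =
    \prod_(z <- belast x (unzip2 t)) (P (A z) * P (B z) * P (C z)).
  apply: (site_independent (M := M)) => // z.
  - exact: (frog_events_eta M z (fun n => 0 < n)%N).
  - exact: (@frog_events_walk _ _ _ _ _ _ _ _ M z 0%N (h z).1 [set (h z).2]).
  - exact: (frog_events_life M z 0%N (measurable_ereal_gt _)).
have -> : (hops_weight x t)%:E = \prod_(z <- belast x (unzip2 t))
    (P (A z) * P (B z) * P (C z)).
  elim: t x ht {uxt ubelast PABC} => [|[n y] t IH] x /=; first by rewrite big_nil.
  move=> [hx /IH ht]; rewrite big_cons -ht EFinM; congr (_ * _).
  rewrite /A eta_gt0_prob /C (life_gt_prob M p01) /B -hx /= /hop_prob /=.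
  have PB : P [set w | walk M x 0 n w = y] \is a fin_num.
    exact: fin_num_measure.
  by rewrite -(fineK PB) -!EFinM /=; congr (_%:E); rewrite mulrAC.
rewrite -PABC; apply: le_measure; rewrite ?inE.
- exact: hops_measurable.
- rewrite bigcap_seq; apply: bigsetI_measurable => z _.
  apply: measurableI; first apply: measurableI.
  + exact: eta_gt0_measurable.
  + exact: walk_at_measurable.
  + exact/frog_events_measurable/(frog_events_life M z 0%N (measurable_ereal_gt _)).
- move=> w /= hw z; elim: t x ht hw {uxt ubelast PABC} => [|[n y] t IH] x //=.
  move=> [hx /IH ht] [[_ h1 h2 h3] /ht{}ht]; rewrite inE => /predU1P[->|//].
  by rewrite /A /B /C /= -hx.
Qed.

Hypothesis q0 : (0 <= q)%R.

Lemma hop_prob_ge0 x h : (0 <= hop_prob x h)%R.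
Proof.
have /andP[p0 _] := p01.
by rewrite /hop_prob !mulr_ge0 // ?exprn_ge0 // fine_ge0.
Qed.

Lemma hops_weight_ge0 x t : (0 <= hops_weight x t)%R.
Proof.
elim: t x => [|h t IH] x //=.
by rewrite mulr_ge0 // hop_prob_ge0.
Qed.

(** At a given age the positions are mutually exclusive, so summing over [y] leaves at most q p^n.
    The constant is the sum of q p^n over n >= 1, the mean number of steps of the particle. *)
Lemma sum_hop_prob N x :
  (\sum_(h <- [seq (n, y) | n <- iota 1 N, y <- ball e root N]) hop_prob x h
    <= q * p / (1 - p))%R.
Proof.
have /andP[p0 p1] := p01.
rewrite big_allpairs_dep /=.
apply: (@le_trans _ _ (\sum_(n <- iota 1 N) q * p ^+ n)%R).
  apply: ler_sum => n _; rewrite /hop_prob /= -big_distrr /=.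
  rewrite ler_piMr // ?mulr_ge0 ?exprn_ge0 // -lee_fin -sumEFin.
  rewrite (eq_bigr (fun y => P (setT `&` [set w | walk M x 0 n w = y]))).
    rewrite -measure_seq_partition ?ball_uniq //; last first.
      by move=> y _; rewrite setTI.
    apply: probability_le1; rewrite setTI.
    exact: (walk_measurable M x 0 n [set y | y \in ball e root N]).
  by move=> y _; rewrite setTI fineK // fin_num_measure.
rewrite -big_distrr /= -mulrA ler_wpM2l // ler_pdivlMr ?subr_gt0 //.
suff -> : ((\sum_(n <- iota 1 N) p ^+ n) * (1 - p) = p - p ^+ N.+1)%R.
  by rewrite gerBl exprn_ge0.
elim: N => [|N IH]; first by rewrite big_nil mul0r expr1 subrr.
rewrite -[in LHS](addn1 N) iotaD big_cat big_seq1 mulrDl IH add1n !exprS.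
ring.
Qed.

Lemma sum_hops_weight N k x :
  (\sum_(t <- hop_seqs N k) hops_weight x t <= (q * p / (1 - p)) ^+ k)%R.
Proof.
have /andP[p0 p1] := p01.
have a0 : (0 <= q * p / (1 - p))%R by rewrite divr_ge0 ?mulr_ge0 // subr_ge0 ltW.
elim: k x => [|k IH] x /=; first by rewrite big_seq1 expr0.
rewrite big_allpairs_dep /= exprS.
apply: le_trans (ler_wpM2r (exprn_ge0 k a0) (sum_hop_prob N x)).
rewrite big_distrl /=; apply: ler_sum => h _; rewrite -big_distrr /=.
by apply: ler_wpM2l => //; exact: hop_prob_ge0.
Qed.

Lemma chain_event_prob N k :
  P (chain_event root M N k) <= ((q * p / (1 - p)) ^+ k)%:E.
Proof.
(* Union bound over all ages and sites. Sequences that repeat a site produce no chain and receive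
   the empty event, as [hops_prob] covers distinct sites only. *)
pose F t := if uniq (root :: unzip2 t) then [set w | hops w root t] else set0.
have mF t : measurable (F t).
  by rewrite /F; case: ifP => // _; exact: hops_measurable.
apply: (@le_trans _ _ (P (\big[setU/set0]_(t <- hop_seqs N k) F t))).
  apply: le_measure; rewrite ?inE; [exact: chain_event_measurable| |].
    exact: bigsetU_measurable.
  rewrite -bigcup_seq => w [s [sk us sN ps]].
  suff [t [tk ts ht]] : exists t,
      [/\ t \in hop_seqs N k, unzip2 t = s & hops w root t].
    by exists t => //; rewrite /F ts us.
  have {us} : forall s k x, size s = k -> {subset s <= ball e root N} ->
      path (fun x y => y \in visited (first_particle M N x w)) x s ->
      exists t, [/\ t \in hop_seqs N k, unzip2 t = s & hops w x t].
    elim=> [|y s' IH] [|k'] //= x => [_ _ _|[sk'] sN' /andP[xy ps']].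
      by exists [::].
    have [|t [tk ts ht]] := IH k' y sk' _ ps'.
      by move=> z zs; apply: sN'; rewrite inE zs orbT.
    have /visited_first_particle[n nN vn] := xy.
    exists ((n, y) :: t); split => //=; last by rewrite ts.
    apply: allpairs_f => //; apply: allpairs_f.
      by rewrite mem_iota add1n ltnS nN andbT; case: vn.
    by apply: sN'; rewrite inE eqxx.
  by apply.
apply: le_trans (measure_bigsetU_le P _ mF) _.
apply: (@le_trans _ _ (\sum_(t <- hop_seqs N k) (hops_weight root t)%:E)).
  apply: lee_sum => t _; rewrite /F; case: ifP => [/hops_prob//|_].
  by rewrite measure0 lee_fin hops_weight_ge0.
by rewrite sumEFin lee_fin sum_hops_weight.
Qed.

End extinction.
End zero_one_model.

(** * Comparison of two frog models *)

Lemma ae_le_measure (R : realType) d (T : measurableType d)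
    (P : probability T R) (A B : set T) : measurable A -> measurable B ->
  {ae P, forall w, A w -> B w} -> P A <= P B.
Proof.
move=> mA mB AB.
have AB0 : P (A `\` B) = 0.
  apply/negligibleP; first exact: measurableD.
  by apply: negligibleS AB => w /= [Aw Bw] /(_ Aw).
apply: (@le_trans _ _ (P (A `&` B))); last exact: measureIr.
rewrite -{1}(setUIDK A B) measureU //=.
- by rewrite -[leRHS]adde0; apply: leeD2l; rewrite AB0.
- exact: measurableI.
- exact: measurableD.
- by rewrite setIDA setIAC -setIA setDE -!setIA setICr !setI0.
Qed.

(** Comparison on the ball suffices, so the coordinates outside can be frozen at any value. *)
Lemma chain_mono (V : choiceType) (e : rel V) (root : V) N k c c' :
  (forall x, x \in ball e root N -> {subset visited (c x) <= visited (c' x)}) ->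
  chain e root N k c -> chain e root N k c'.
Proof.
move=> cc' [s [sk us sN ps]]; exists s; split => //.
apply: (@sub_in_path _ (mem (ball e root N)) _ _ _ root s _ ps).
  by move=> x y xN _; exact: cc'.
by apply/andP; split; [exact: root_ball|apply/allP].
Qed.

(** * Domination of truncated geometric laws *)

Section geometric_weights.
Variable R : realType.

(* Law of the number of steps made up to time [N] by a particle that survives
   each step with probability [p]. *)
Definition step_weight (p : R) (N l : nat) : R :=
  (if (l < N)%N then p ^+ l - p ^+ l.+1 else p ^+ N)%R.

Lemma step_weight_ge0 p N l : (0 <= p <= 1)%R -> (0 <= step_weight p N l)%R.
Proof.
move=> /andP[p0 p1]; rewrite /step_weight; case: ifP => _; last exact: exprn_ge0.
by rewrite subr_ge0 exprS ler_piMl // exprn_ge0.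
Qed.

(** Summation by parts: p^(l+1) is the probability of making more than [l] steps, so the mean of [h]
    depends on the law through its tails. *)
Lemma sum_step_weight p N (h : nat -> R) :
  (\sum_(l <- iota 0 N.+1) step_weight p N l * h l =
   h 0 + \sum_(0 <= l < N) p ^+ l.+1 * (h l.+1 - h l))%R.
Proof.
rewrite -[iota _ _]/(index_iota 0 N.+1) big_nat_recr //= {2}/step_weight ltnn.
rewrite (eq_big_nat _ _ (F2 := fun l => ((p ^+ l - p ^+ l.+1) * h l)%R)); last first.
  by move=> l /andP[_ lN]; rewrite /step_weight lN.
elim: N => [|N IH]; first by rewrite !big_geq // add0r expr0 mul1r addr0.
rewrite !big_nat_recr //= [RHS]addrA -IH; ring.
Qed.

(** [h1] and [h0] are the values for a present and for an absent particle. Replacing [h0 l] by the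
    smaller [h1 0] treats an absent particle as one that makes no step, whence the tails q
    p^(l+1). *)
Lemma step_weight_dominated (p p' q : R) N (h1 h0 : nat -> R) :
  (0 <= p' <= 1)%R -> (0 <= p <= 1)%R -> (0 <= q <= 1)%R -> (p' <= q * p)%R ->
  (forall l, h1 l <= h1 l.+1)%R -> (forall l, h1 0 <= h0 l)%R ->
  (\sum_(l <- iota 0 N.+1) step_weight p' N l * h1 l <=
   \sum_(l <- iota 0 N.+1) step_weight p N l * (q * h1 l + (1 - q) * h0 l))%R.
Proof.
move=> /andP[p'0 p'1] p01 /andP[q0 q1] p'p h1S h10.
have [p0 p1] := andP p01.
apply: (@le_trans _ _ (\sum_(l <- iota 0 N.+1)
    step_weight p N l * (q * h1 l + (1 - q) * h1 0))%R); last first.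
  apply: ler_sum => l _; apply: ler_wpM2l; first exact: step_weight_ge0.
  by rewrite lerD2l ler_wpM2l // subr_ge0.
(* Summation by parts turns domination of the tails into domination. *)
rewrite !sum_step_weight.
rewrite (_ : (q * h1 0%N + (1 - q) * h1 0%N)%R = h1 0%N) ?lerD2l; last by ring.
apply: ler_sum => l _.
rewrite (_ : (q * h1 l.+1 + (1 - q) * h1 0%N - (q * h1 l + (1 - q) * h1 0%N))%R =
  (q * (h1 l.+1 - h1 l))%R); last by ring.
rewrite mulrA ler_wpM2r ?subr_ge0 // mulrC !exprS.
(* One factor is compared by [p' <= q * p], the [l] others by [p' <= p]. *)
rewrite mulrA ler_pM ?exprn_ge0 //; apply: lerXn2r; rewrite ?nnegrE //.
by apply: le_trans p'p _; rewrite ler_piMl.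
Qed.

End geometric_weights.

(** * Joint law of trajectory, lifetime and presence at one site *)

Section first_particle_law.
Variables (R : realType) (V : choiceType) (e : rel V) (p q : R) (root : V).
Hypothesis G : infinite_connected_graph e.

Lemma srw_path_prob_ge0 x s : (0 <= srw_path_prob R e x s)%R.
Proof.
elim: s x => [|y s IH] x /=; first exact: ler01.
by rewrite mulr_ge0 //; case: ifP => _; rewrite ?invr_ge0 ?ler0n.
Qed.

Definition particle_values (N : nat) (x : V) : seq (seq V * nat * bool) :=
  [seq (z, b) | z <- [seq (x :: s, l) | s <- walks e N x, l <- iota 0 N.+1],
                b <- [:: true; false]].

(* The law of [first_particle], on [particle_values N x] only. *)
Definition particle_weight (N : nat) (x : V) (a : seq V * nat * bool) : R :=
  ((if a.2 then q else 1 - q) * srw_path_prob R e x (behead a.1.1) *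
   step_weight p N a.1.2)%R.

Lemma particle_values_uniq N x : uniq (particle_values N x).
Proof.
apply: allpairs_uniq => //; last by move=> [? ?] [? ?].
apply: allpairs_uniq; [exact: walks_uniq|exact: iota_uniq|].
by move=> [s l] [t m] _ _ /= [-> ->].
Qed.

Lemma mem_particle_values N x a : a \in particle_values N x ->
  exists s, [/\ a.1.1 = x :: s, size s = N & (a.1.2 <= N)%N].
Proof.
move=> /allpairsP[[z b] [/allpairsP[[s m] [sN mN zl]] _ ->]].
move: sN zl mN; rewrite mem_iota => /= sN -> mN; exists s.
by split => //; have [] := mem_walks G sN.
Qed.

(** The trajectory has the same law in both models; factoring it out reduces their comparison to
    lifetime and presence along a fixed trajectory. *)
Lemma sum_particle_weight N x (h : seq V * nat * bool -> R) :
  (\sum_(a <- particle_values N x) particle_weight N x a * h a =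
   \sum_(s <- walks e N x) srw_path_prob R e x s *
     \sum_(l <- iota 0 N.+1) step_weight p N l *
       (q * h (x :: s, l, true) + (1 - q) * h (x :: s, l, false)))%R.
Proof.
rewrite /particle_values !big_allpairs_dep; apply: eq_bigr => s _.
rewrite big_distrr /=; apply: eq_bigr => l _.
rewrite big_cons big_seq1 /particle_weight /=; ring.
Qed.

Section model.
Variables (law : probability nat R) (d : measure_display).
Variables (T : measurableType d) (P : probability T R).
Variable M : frog_model e p law P.
Hypothesis p01 : (0 <= p < 1)%R.
Hypothesis law0 : law [set 0%N] = (1 - q)%:E.

Let survived_ge N l : [set z : \bar R | (l <= steps_survived N z)%N] =
  if l is 0 then setT else if (l <= N)%N then [set z | l%:R%:E < z] else set0.
Proof.
case: l => [|l]; first by apply/seteqP; split.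
apply/seteqP; split => z /=; rewrite steps_survived_ge //.
  by move=> /andP[-> lz].
by case: ifP.
Qed.

Let survived_ge_measurable N l : measurable [set z : \bar R | (l <= steps_survived N z)%N].
Proof.
rewrite survived_ge; case: l => // l; case: ifP => _ //.
exact: measurable_ereal_gt.
Qed.

Let survived_eq N l : [set z : \bar R | steps_survived N z = l] =
  [set z : \bar R | (l <= steps_survived N z)%N] `\` [set z | (l.+1 <= steps_survived N z)%N].
Proof.
apply/seteqP; split => z /=; first by move=> ->; split; rewrite ?ltnn.
by move=> [lz /negP]; rewrite -leqNgt => zl; apply/eqP; rewrite eqn_leq zl.
Qed.

Let survived_event N x l : frog_events (fun x => Defs.eta M x : T -> nat)
  (walk M) (fun x i => life M x i : T -> \bar R) (inr (x, 0%N))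
  [set w | steps_survived N (life M x 0 w) = l].
Proof.
apply: (@frog_events_life _ _ _ _ _ _ _ _ M x 0%N [set z : \bar R | steps_survived N z = l]).
by rewrite survived_eq; exact: measurableD.
Qed.

Let survived_prob N x l : (l <= N)%N ->
  P [set w | steps_survived N (life M x 0 w) = l] = (step_weight p N l)%:E.
Proof.
move=> lN.
have hge j : measurable [set w | (j <= steps_survived N (life M x 0 w))%N] /\
    P [set w | (j <= steps_survived N (life M x 0 w))%N] =
      (if (j <= N)%N then p ^+ j else 0)%:E.
  split.
    exact/frog_events_measurable/(frog_events_life M x 0%N (survived_ge_measurable N j)).
  have -> : [set w | (j <= steps_survived N (life M x 0 w))%N] =
      life M x 0 @^-1` [set z | (j <= steps_survived N z)%N] by [].
  rewrite survived_ge; case: j => [|j]; first by rewrite preimage_setT probability_setT.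
  case: ifP => _; first exact: life_gt_prob.
  by rewrite preimage_set0 measure0.
have [mA PA] := hge l; have [mB PB] := hge l.+1.
have -> : [set w | steps_survived N (life M x 0 w) = l] =
    [set w | (l <= steps_survived N (life M x 0 w))%N] `\`
    [set w | (l.+1 <= steps_survived N (life M x 0 w))%N].
  apply/seteqP; split => w /=; first by move=> ->; split; rewrite ?ltnn.
  by move=> [lz /negP]; rewrite -leqNgt => zl; apply/eqP; rewrite eqn_leq zl.
transitivity (P [set w | (l <= steps_survived N (life M x 0 w))%N] -
    P [set w | (l.+1 <= steps_survived N (life M x 0 w))%N]).
  rewrite measureD //.
    by rewrite setIidr // => w /=; exact: ltnW.
  by apply: le_lt_trans (probability_le1 _ mA) _; rewrite ltry.
rewrite PA PB lN /step_weight -EFinB; case: ltnP => // Nl.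
by rewrite subr0 (_ : l = N) //; apply/eqP; rewrite eqn_leq lN.
Qed.

Let eta_prob x (b : bool) :
  P [set w | (0 < Defs.eta M x w)%N = b] = (if b then q else 1 - q)%:E.
Proof.
case: b; first exact: eta_gt0_prob.
rewrite (_ : [set w | _] = ~` [set w | (0 < Defs.eta M x w)%N]).
  rewrite probability_setC; last exact: eta_gt0_measurable.
  by rewrite (eta_gt0_prob M law0).
by apply/seteqP; split => w /=; [move=> ->|move=> /negP/negbTE].
Qed.

Let first_particle_eq N x a : [set w | first_particle M N x w = a] =
  [set w | (0 < Defs.eta M x w)%N = a.2] `&`
  [set w | walk_prefix M N x 0 w = a.1.1] `&`
  [set w | steps_survived N (life M x 0 w) = a.1.2].
Proof.
case: a => [[s l] b]; apply/seteqP; split => w /=; rewrite /first_particle.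
  by move=> [-> -> ->].
by move=> [[-> ->] ->].
Qed.

Let first_particle_measurable N x a :
  measurable [set w | first_particle M N x w = a].
Proof.
rewrite first_particle_eq; apply: measurableI; first apply: measurableI.
- exact/frog_events_measurable/(frog_events_eta M x (fun n => (0 < n)%N = a.2)).
- exact: (frog_events_measurable (@frog_events_walk_prefix _ _ _ _ _ _ _ _ M N x 0%N a.1.1)).
- exact: frog_events_measurable (survived_event N x a.1.2).
Qed.

Let first_particle_independent N s c : uniq s ->
  (forall x, x \in s -> c x \in particle_values N x) ->
  P (\bigcap_(x in [set` s]) [set w | first_particle M N x w = c x]) =
  (\prod_(x <- s) particle_weight N x (c x))%:E.
Proof.
move=> us cA.
under eq_bigcapr do rewrite first_particle_eq.
have PABC := @site_independent _ _ _ _ _ _ _ _ M s _ _ _ us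
  (fun x => frog_events_eta M x (fun n => (0 < n)%N = (c x).2))
  (fun x => @frog_events_walk_prefix _ _ _ _ _ _ _ _ M N x 0%N (c x).1.1)
  (fun x => survived_event N x (c x).1.2).
rewrite PABC.
rewrite -prodEFin; apply: eq_big_seq => x /cA /mem_particle_values[t [ct tN lN]].
rewrite eta_prob survived_prob // ct -tN walk_prefix_law tN.
by rewrite /particle_weight ct /= !EFinM.
Qed.

Let first_particle_support N x :
  P [set w | first_particle M N x w \in particle_values N x] = 1.
Proof.
have -> : [set w | first_particle M N x w \in particle_values N x] =
    [set w | walk_prefix M N x 0 w \in map (cons x) (walks e N x)].
  apply/seteqP; split => w /=.
    move=> /allpairsP[[z b] [/allpairsP[[s m] [sN _ zs]] _ wz]].
    have {}wz : first_particle M N x w = (z, b) := wz.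
    have wE : walk_prefix M N x 0 w = z.1 by rewrite -[RHS]/((z, b).1.1) -wz.
    have {}zs : z = (x :: s, m) := zs.
    by rewrite wE zs; exact: map_f.
  move=> /mapP[s sN ws]; apply: allpairs_f.
    rewrite ws; apply: (allpairs_f (fun s l => (x :: s, l))) => //.
    rewrite mem_iota leq0n add0n ltnS /=.
    exact: steps_survived_le.
  by rewrite !inE; case: (0 < _)%N.
have mB : measurable [set w | walk_prefix M N x 0 w \in map (cons x) (walks e N x)].
  rewrite (_ : [set w | _] = \big[setU/set0]_(a <- map (cons x) (walks e N x))
      [set w | walk_prefix M N x 0 w = a]).
    apply: bigsetU_measurable => a _.
    exact: (frog_events_measurable (@frog_events_walk_prefix _ _ _ _ _ _ _ _ M N x 0%N a)).
  rewrite -bigcup_seq; apply/seteqP; split => w /=.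
    by move=> h; exists (walk_prefix M N x 0 w).
  by move=> [a aA wa]; rewrite wa.
apply/eqP; rewrite eq_le probability_le1 //= -(@probability_setT _ _ _ P).
apply: ae_le_measure => //.
have := walk_prefix_walks M G N x 0%N; apply: negligibleS => w /= h.
by apply/negP => wx; apply: h.
Qed.

(** The right-hand side no longer refers to the probability space, which makes models on different
    spaces comparable. Sites outside the ball keep the value [c0]; no chain leaves from them. *)
Lemma chain_event_expectation N k (c0 : V -> seq V * nat * bool) :
  P (chain_event root M N k) =
  (expectation (particle_values N) (particle_weight N) (ball e root N)
     (fun c => (`[< chain e root N k c >])%:R) c0)%:E.
Proof.
rewrite -(probability_expectation (P := P) (X := first_particle M N)
  (g := chain e root N k)) //.
- congr (P _); apply/seteqP; split => w; apply: chain_mono => x xN y.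
  + by rewrite /resample xN.
  + by rewrite /resample xN.
- exact: particle_values_uniq.
- exact: first_particle_independent.
- move=> s c; apply: (@chain_measurable V e root d T G N k
    (fun w => resample s c (first_particle M N ^~ w))).
  move=> x y; rewrite /resample /=.
  case: (x \in s); last exact: measurable_cst_prop.
  exact: visited_measurable.
- exact: (ball_uniq e root N).
Qed.

End model.
End first_particle_law.

Lemma chain_event_dominated (R : realType) (V : choiceType) (e : rel V)
    (root : V) (p q : R) (law : probability nat R) (d : measure_display)
    (T : measurableType d) (P : probability T R) (M : frog_model e p law P)
    (p' : R) (law' : probability nat R) (d' : measure_display)
    (T' : measurableType d') (P' : probability T' R)
    (M' : frog_model e p' law' P') N k :
  infinite_connected_graph e ->
  (0 <= p < 1)%R -> (0 <= q <= 1)%R -> law [set 0%N] = (1 - q)%:E ->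
  (0 <= p' < 1)%R -> law' [set 0%N] = 0 -> (p' <= q * p)%R ->
  P' (chain_event root M' N k) <= P (chain_event root M N k).
Proof.
move=> G p01 q01 law0 p'01 law'0 p'_le.
have [[p0 p1] [p'0 p'1]] := (andP p01, andP p'01).
(* The model with one particle per site is treated as the 0-1 model of parameter 1. *)
have law'0' : law' [set 0%N] = (1 - 1)%:E by rewrite subrr.
have q1 : (0 <= (1 : R) <= 1)%R by rewrite ler01 lexx.
pose c0 (x : V) : seq V * nat * bool := ([::], 0%N, false).
rewrite (chain_event_expectation root G M p01 law0 N k c0).
rewrite (chain_event_expectation root G M' p'01 law'0' N k c0) lee_fin.
have weight_ge0 (r t : R) x a : (0 <= r < 1)%R -> (0 <= t <= 1)%R ->
    (0 <= particle_weight e r t N x a)%R.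
  move=> /andP[r0 r1] /andP[t0 t1]; rewrite /particle_weight !mulr_ge0 //.
  - by case: ifP => _ //; rewrite subr_ge0.
  - exact: srw_path_prob_ge0.
  - by apply: step_weight_ge0; rewrite r0 ltW.
(* Triples are ordered by inclusion of the visited sites. Along a fixed trajectory these grow with
   the number of steps, and they are empty both without a step and without a particle. *)
apply: (expectation_dominated
  (le := fun a b => {subset visited a <= visited b})) => //.
- by move=> a y.
- move=> c c' cc'; have [cc|ncc] := pselect (chain e root N k c).
    by rewrite !asboolT //; apply: chain_mono cc => x _; exact: cc'.
  by rewrite (asboolF ncc) ler0n.
- by move=> x a; exact: weight_ge0.
- by move=> x a; exact: weight_ge0.
move=> x h hmono; rewrite !sum_particle_weight.
apply: ler_sum => s _; apply: ler_wpM2l; first exact: srw_path_prob_ge0.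
under eq_bigr do rewrite mul1r subrr mul0r addr0.
apply: (@step_weight_dominated R p p' q N (fun l => h (x :: s, l, true))
  (fun l => h (x :: s, l, false))) => //.
- by rewrite p'0 ltW.
- by rewrite p0 ltW.
- by move=> l; apply: hmono => y; rewrite /visited /= -(take_takel _ (leqnSn l)) => /mem_take.
- by move=> l; apply: hmono => y; rewrite /visited /= take0.
Qed.

(** * Extinction and survival *)

Section zero_one_survival.
Variables (R : realType) (V : choiceType) (e : rel V) (root : V).
Hypothesis G : infinite_connected_graph e.
Variables (p q : R) (law : probability nat R) (d : measure_display).
Variables (T : measurableType d) (P : probability T R).
Variable M : frog_model e p law P.
Hypothesis p01 : (0 <= p < 1)%R.
Hypothesis q01 : (0 <= q <= 1)%R.
Hypothesis law1 : law [set 1%N] = q%:E.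
Hypothesis law0 : law [set 0%N] = (1 - q)%:E.

Definition has_chain (k : nat) : set T := \bigcup_N chain_event root M N k.

Lemma has_chain_measurable k : measurable (has_chain k).
Proof. by apply: bigcupT_measurable => N; exact: chain_event_measurable. Qed.

Lemma has_chain_prob_le k (b : \bar R) :
  (forall N, P (chain_event root M N k) <= b) -> P (has_chain k) <= b.
Proof.
move=> hb; have cv := @nondecreasing_cvg_mu _ _ _ P (chain_event root M ^~ k)
  (fun N => chain_event_measurable root M G N k) (has_chain_measurable k)
  (@chain_event_nondecreasing _ _ _ _ root _ _ _ _ M k).
by apply: (cvge_to_le cv); apply: nearW => N; exact: hb.
Qed.

Lemma bigcap_has_chain_measurable : measurable (\bigcap_k has_chain k).
Proof. by apply: bigcapT_measurable => k; exact: has_chain_measurable. Qed.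

Lemma survives_has_chain_ae :
  {ae P, forall w, survives M root w <-> (\bigcap_k has_chain k) w}.
Proof.
apply: filterS (survives_iff_chains_ae root M G p01 law1 law0) => w [h1 h2].
split.
  by move=> /h1 h k _; have [N hN] := h k; exists N.
by move=> h; apply: h2 => k; have [N _ hN] := h k I; exists N.
Qed.

Lemma dies_out : (q * p < 1 - p)%R -> {ae P, forall w, ~ survives M root w}.
Proof.
move=> qp; have [p0 p1] := andP p01; have [q0 q1] := andP q01.
have P0 : P (\bigcap_k has_chain k) = 0.
  have fP : P (\bigcap_k has_chain k) \is a fin_num.
    by apply: fin_num_measure; exact: bigcap_has_chain_measurable.
  apply/eqP; rewrite -(fineK fP) eqe eq_le fine_ge0 // andbT leNgt.
  have a01 : (0 <= q * p / (1 - p) < 1)%R.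
    rewrite ltr_pdivrMr ?subr_gt0 // mul1r qp andbT.
    by apply: divr_ge0; [exact: mulr_ge0|rewrite subr_ge0 ltW].
  apply/negP => /(expr_lt_eps a01)[m /(_ m (leqnn m))].
  rewrite ltNge => /negP; apply; rewrite -lee_fin fineK //.
  apply: (@le_trans _ _ (P (has_chain m))).
    apply: le_measure; rewrite ?inE; [exact: bigcap_has_chain_measurable|
      exact: has_chain_measurable|by move=> w; apply].
  by apply: has_chain_prob_le => N; exact: (chain_event_prob root M G p01 law0).
have ae0 : {ae P, forall w, ~ (\bigcap_k has_chain k) w}.
  apply: (@negligibleS _ _ _ P (\bigcap_k has_chain k)).
    by move=> w /= /contrapT.
  by apply/negligibleP => //; exact: bigcap_has_chain_measurable.
by apply: filterS2 survives_has_chain_ae ae0 => w [h1 h2] nh /h1.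
Qed.

(** The events [has_chain k] decrease with [k], so a lower bound uniform in [k] passes to their
    intersection by continuity from above. *)
Lemma survival_ge (b : \bar R) :
  (forall k, b <= P (has_chain k)) -> b <= P (survives M root).
Proof.
move=> hb; apply: (@le_trans _ _ (P (\bigcap_k has_chain k))).
  have cv := @nonincreasing_cvg_mu _ _ _ P has_chain
    (le_lt_trans (probability_le1 P (has_chain_measurable 0)) (ltry 1))
    has_chain_measurable bigcap_has_chain_measurable.
  apply: (cvge_to_ge (cv _)); last by apply: nearW => k; exact: hb.
  apply/nonincreasing_seqP => k; apply/subsetPset => w [N _ hN].
  by exists N => //; exact: chain_event_nonincreasing hN.
apply: ae_le_measure; first exact: bigcap_has_chain_measurable.
  exact: survives_measurable.
by apply: filterS survives_has_chain_ae => w [].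
Qed.

End zero_one_survival.

Lemma survival_dominated (R : realType) (V : choiceType) (e : rel V) (root : V)
    (p q : R) (law : probability nat R) (d : measure_display)
    (T : measurableType d) (P : probability T R) (M : frog_model e p law P)
    (p' : R) (law' : probability nat R) (d' : measure_display)
    (T' : measurableType d') (P' : probability T' R)
    (M' : frog_model e p' law' P') :
  infinite_connected_graph e -> (0 <= p < 1)%R -> (0 <= q <= 1)%R ->
  law [set 1%N] = q%:E -> law [set 0%N] = (1 - q)%:E ->
  (0 <= p' < 1)%R -> law' [set 1%N] = 1 -> law' [set 0%N] = 0 ->
  (p' <= q * p)%R ->
  P' (survives M' root) <= P (survives M root).
Proof.
move=> G p01 q01 law1 law0 p'01 law'1 law'0 p'_le.
have law'0' : law' [set 0%N] = (1 - 1)%:E by rewrite subrr.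
apply: (survival_ge G p01 law1 law0) => k.
apply: (@le_trans _ _ (P' (has_chain root M' k))).
  apply: ae_le_measure; [exact: survives_measurable|exact: has_chain_measurable|].
  apply: filterS (survives_has_chain_ae root G M' p'01 law'1 law'0') => w [h _].
  by move=> /h; apply.
apply: has_chain_prob_le => // N.
apply: le_trans (chain_event_dominated root M M' N k G p01 q01 law0 p'01 law'0 p'_le) _.
apply: le_measure; rewrite ?inE; [exact: chain_event_measurable|
  exact: has_chain_measurable|by move=> w hw; exists N].
Qed.

Theorem proposition1p3 (R : realType) (V : choiceType) (e : rel V) (root : V)
    (G_graph : infinite_connected_graph e) (p : R)
    (pc_lt_p : critical_parameter e root (\d_1%N : probability nat R) < p%:E)
    (p_lt1 : (p < 1)%R)
    (eta_ : R -> probability nat R)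
    (eta_01 : forall q : R, (0 < q <= 1)%R ->
       eta_ q [set 1%N] = q%:E /\ eta_ q [set 0%N] = (1 - q)%:E) :
  exists q0 q1 : R,
    [/\ (0 < q0)%R, (q0 <= q1)%R, (q1 < 1)%R,
        forall q : R, (0 < q < q0)%R ->
          forall (d : measure_display) (T : measurableType d)
                 (P : probability T R) (M : frog_model e p (eta_ q) P),
            {ae P, forall w, ~ survives M root w}
      & forall q : R, (q1 < q <= 1)%R ->
          forall (d : measure_display) (T : measurableType d)
                 (P : probability T R) (M : frog_model e p (eta_ q) P),
            0 < P (survives M root)].
Proof.
have [_ [p' [/andP[p'0 _] [d' [T' [P' [M' surv]]]]] <-]] := ereal_inf_lt pc_lt_p.
rewrite lte_fin => p'p.
have p0 : (0 < p)%R := le_lt_trans p'0 p'p.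
have p01 : (0 <= p < 1)%R by rewrite ltW.
have p'01 : (0 <= p' < 1)%R by rewrite p'0 (lt_trans p'p).
(* If [q < 1 - p] then q p <= q < 1 - p, which gives extinction; if [q > p' / p] then p' <= q p,
   which gives survival. The maximum secures [q0 <= q1], and also [q > 0] in the second case when
   [p'] is 0. *)
exists (1 - p)%R, (Num.max (1 - p) (p' / p))%R; split.
- by rewrite subr_gt0.
- by rewrite le_max lexx.
- by rewrite gt_max gtrBl p0 ltr_pdivrMr // mul1r.
- move=> q /andP[q0 qp] d T P M.
  have q1 : (q <= 1)%R by apply: le_trans (ltW qp) _; rewrite gerBl ltW.
  have [law1 law0] := eta_01 q (introT andP (conj q0 q1)).
  apply: (@dies_out _ _ _ root G_graph _ q _ _ _ _ M p01 _ law1 law0); first by rewrite ltW.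
  by apply: le_lt_trans qp; rewrite ler_piMr // ltW.
- move=> q /andP[]; rewrite gt_max => /andP[qp p'q] q1 d T P M.
  have q0 : (0 < q)%R by apply: lt_trans qp; rewrite subr_gt0.
  have [law1 law0] := eta_01 q (introT andP (conj q0 q1)).
  apply: lt_le_trans surv _.
  apply: (survival_dominated root M M' G_graph p01 _ law1 law0 p'01).
  + by rewrite ltW.
  + by rewrite /= diracE mem_set.
  + by rewrite /= diracE memNset.
  + by rewrite ltW // -ltr_pdivrMr.
Qed.
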